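(* Let $R$ be a ring of cardinality $\tau$. Then $R^{(\tau^{+})}$, regarded as a left $R$-module, is $\tau^{+}$-saturated if and only if $R$ is left perfect and right coherent.
   Context: $R^{(\tau^+)}$ is the direct sum of $\tau^+$ copies of $R$, i.e. the free left $R$-module on $\tau^+$ generators. Saturation is with respect to the usual first-order language of left $R$-modules. ''Left perfect'' and ''right coherent'' are the standard ring-theoretic notions (left perfect: every left $R$-module has a projective cover; right coherent: every finitely generated right ideal is finitely presented). Rings are associative with $1$. *)

(* Defs.v *)
From HB Require Import structures.
From mathcomp Require Import all_boot all_order all_algebra.
From mathcomp Require Import mathcomp_extra boolp classical_sets functions.
From mathcomp Require Import cardinality.

Set Implicit Arguments.
Unset Strict Implicit.
Unset Printing Implicit Defensive.

Import GRing.Theory.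

Local Open Scope classical_set_scope.
Local Open Scope card_scope.
Local Open Scope ring_scope.

Definition card_lt (T U : Type) (A : set T) (B : set U) : Prop :=
  A #<= B /\ ~ (B #<= A).

(* |I| is the least cardinal above |T|. Every cardinal up to |I| is the
   cardinal of a subset of I, so leastness is tested on these. *)
Definition succ_card (T I : Type) : Prop :=
  card_lt [set: T] [set: I] /\
  forall J : set I, card_lt [set: T] J -> [set: I] #<= J.

(* First-order language of left R-modules, expanded by a set C of constants.
   A formula of type [mformula R C n] has its free variables among 'I_n;
   [FEx] binds the variable ord0 of its body and shifts the others. *)

Inductive mterm (R C : Type) (n : nat) : Type :=
| TVar of 'I_n
| TConst of C
| TZero
| TOpp of mterm R C n
| TAdd of mterm R C n & mterm R C n
| TScale of R & mterm R C n.

Inductive mformula (R C : Type) (n : nat) : Type :=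
| FEq of mterm R C n & mterm R C n
| FNot of mformula R C n
| FAnd of mformula R C n & mformula R C n
| FEx of mformula R C n.+1.

Definition env_cons (M : Type) (n : nat) (x : M) (e : 'I_n -> M) :
    'I_n.+1 -> M :=
  fun i => oapp e x (unlift ord0 i).

Fixpoint teval (R : pzRingType) (M : lmodType R) (C : Type) (c : C -> M)
    (n : nat) (e : 'I_n -> M) (t : mterm R C n) : M :=
  match t with
  | TVar i => e i
  | TConst a => c a
  | TZero => 0
  | TOpp u => - teval c e u
  | TAdd u v => teval c e u + teval c e v
  | TScale r u => r *: teval c e u
  end.

Fixpoint satisfies (R : pzRingType) (M : lmodType R) (C : Type) (c : C -> M)
    (n : nat) (e : 'I_n -> M) (f : mformula R C n) : Prop :=
  match f with
  | FEq t u => teval c e t = teval c e u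
  | FNot g => ~ satisfies c e g
  | FAnd g h => satisfies c e g /\ satisfies c e h
  | FEx g => exists x : M, satisfies c (env_cons x e) g
  end.

Definition realizes (R : pzRingType) (M : lmodType R) (A : set M) (x : M)
    (p : set (mformula R A 1)) : Prop :=
  forall f, p f -> satisfies set_val (fun=> x) f.

Definition is_1type (R : pzRingType) (M : lmodType R) (A : set M)
    (p : set (mformula R A 1)) : Prop :=
  forall q : set (mformula R A 1), finite_set q -> q `<=` p ->
    exists x : M, realizes x q.

(* |K|-saturation, with types taken to be finitely satisfiable sets of formulas,
   complete or not. *)
Definition saturated (K : Type) (R : pzRingType) (M : lmodType R) : Prop :=
  forall A : set M, card_lt A [set: K] ->
  forall p : set (mformula R A 1), is_1type p -> exists x : M, realizes x p.

Section Submodule.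
Context (R : pzRingType) (V : lmodType R) (J : submodClosed V).

Definition submod_of : Type := {x : V | x \in J}.

HB.instance Definition _ := SubChoice.on submod_of.
HB.instance Definition _ := [SubChoice_isSubLmodule of submod_of by <:].

End Submodule.

Definition fin_supp (R : pzRingType) (I : Type) : {pred I -> R^o} :=
  fun f => `[< finite_set [set i | f i != 0] >].
Arguments fin_supp : clear implicits.

Lemma fin_supp_submod_closed (R : pzRingType) (I : Type) :
  submod_closed (fin_supp R I).
Proof.
split=> [|a f g /asboolP fF /asboolP gF]; apply/asboolP.
  rewrite (_ : [set i | _] = set0) ?finite_set0//.
  by apply/seteqP; split=> i //=; rewrite eqxx.
apply: sub_finite_set (_ : _ `<=` [set i | f i != 0] `|` [set i | g i != 0]) _.
  move=> i /= h; have [f0|] := eqVneq (f i) 0; last by left.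
  right; apply: contra_neq h => g0.
  by rewrite [LHS](_ : _ = a *: f i + g i)// f0 g0 scaler0 addr0.
by rewrite finite_setU.
Qed.

HB.instance Definition _ (R : pzRingType) (I : Type) :=
  GRing.isSubmodClosed.Build R (I -> R^o) (fin_supp R I)
    (@fin_supp_submod_closed R I).

Definition direct_sum (R : pzRingType) (I : Type) : lmodType R :=
  submod_of (fin_supp R I).

Definition surjective (T U : Type) (f : T -> U) : Prop :=
  forall y, exists x, f x = y.

Definition projective (R : pzRingType) (P : lmodType R) : Prop :=
  forall (A B : lmodType R) (g : {linear A -> B}) (h : {linear P -> B}),
    surjective g -> exists k : {linear P -> A}, forall x, g (k x) = h x.

Definition superfluous (R : pzRingType) (V : lmodType R) (K : set V) : Prop :=
  forall N : submodClosed V,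
    (forall x, exists y z, [/\ y \in N, K z & x = y + z]) ->
    forall x, x \in N.

Definition projective_cover (R : pzRingType) (P M : lmodType R)
    (f : {linear P -> M}) : Prop :=
  [/\ projective P, surjective f & superfluous [set x | f x = 0]].

Definition left_perfect (R : pzRingType) : Prop :=
  forall M : lmodType R,
    exists (P : lmodType R) (f : {linear P -> M}), projective_cover f.

Definition finitely_generated (R : pzRingType) (M : lmodType R) : Prop :=
  exists (n : nat) (a : 'I_n -> M),
    forall x, exists c : 'I_n -> R, x = \sum_(i < n) c i *: a i.

Definition finitely_presented (R : pzRingType) (M : lmodType R) : Prop :=
  exists (n m : nat) (f : {linear 'rV[R]_n -> M})
         (g : {linear 'rV[R]_m -> 'rV[R]_n}),
    surjective f /\ forall u, f u = 0 <-> exists v, g v = u.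

(* Right R-modules are left modules over the converse ring R^c; the right
   ideals of R are thus the submodules of R^c^o. *)
Definition right_coherent (R : pzRingType) : Prop :=
  forall J : submodClosed (R^c)^o,
    finitely_generated (submod_of J) -> finitely_presented (submod_of J).

(* Main.v *)
Require Import Defs.
From HB Require Import structures.
From mathcomp Require Import all_boot all_algebra.
From mathcomp Require Import mathcomp_extra boolp classical_sets functions.
From mathcomp Require Import cardinality fsbigop filter.

Set Implicit Arguments.
Unset Strict Implicit.
Unset Printing Implicit Defensive.

Import GRing.Theory.

Local Open Scope classical_set_scope.
Local Open Scope card_scope.
Local Open Scope ring_scope.

(** Write F for the free left module on the index set I. Two properties of R
    carry the proof: syzygies of finite families of elements of R are finitely
    generated on the right ([rsyz_fg], which is right coherence), and finitely
    generated right ideals satisfy the descending chain condition ([fgr_dcc],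
    which is left perfection).

    Perfection. Given a descending chain of finitely generated right ideals,
    the matrices expressing the generators of each ideal through those of the
    preceding one define, as in Bass's argument, a telescope of free modules
    whose colimit is flat. A flat module with a projective cover is projective,
    and a section of the colimit sends the class of the vectors of generators to
    an element whose coordinates lie in all ideals at once and generate a right
    ideal containing some term of the chain ([perfect_dcc]). Conversely, the
    chain condition on principal right ideals makes the Jacobson radical J left
    T-nilpotent, hence gives Nakayama's lemma for all modules, and produces a
    local idempotent in every right ideal not inside J; a family of elements
    e m of M, with e a local idempotent, that is maximal among those independent
    modulo J then gives a projective cover of M ([dcc_perfect]).

    Saturation from the two properties. Over a right coherent ring the subgroups
    of R defined by positive primitive (pp) formulas are exactly the finitely
    generated right ideals, and pp formulas are evaluated coordinatewise in F
    ([pp_dsum]). So the solution set in F of a pp formula f, if nonempty, is a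
    coset of the group of vectors with all coordinates in such an ideal G;
    adding to a solution, in fresh coordinates, a finite set of generators of G
    gives a generic solution, which satisfies a pp formula only if every
    solution of f does ([generic_solution]). Generic solutions eliminate
    quantifiers down to pp formulas ([pp_determined]). They also realize types:
    extend the type to an ultrafilter, choose by the chain condition a pp
    formula of the ultrafilter with least subgroup, and take a generic solution
    ([realize_type]). Fresh coordinates are available because fewer than |I|
    parameters, each of finite support, cannot exhaust I.

    The two properties from saturation. If a pp subgroup of R were not finitely
    generated, the type of an element of it lying in no finitely generated
    subideal would be realized in F by an element of finite support, which is
    absurd ([saturated_ppR_fg]). If a chain of ideals were strictly decreasing,
    the type of an infinite sum of witnesses placed in distinct coordinates
    would be realized by an element of infinite support ([saturated_dcc]).

    When R is finite, so is F: it is saturated for trivial reasons and R has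
    both properties. *)

(** * Direct sums and free modules *)

Section DirectSum.
Context (R : pzRingType) (T : Type).
Local Notation F := (direct_sum R T).

Definition dcoord (i : T) (x : F) : R^o := \val x i.

Lemma dcoord_linear i : linear (dcoord i).
Proof. by []. Qed.

HB.instance Definition _ i :=
  GRing.isLinear.Build R F R^o _ (dcoord i) (dcoord_linear i).

Lemma dsum_ext (x y : F) : (forall i, dcoord i x = dcoord i y) -> x = y.
Proof. by move=> e; apply/val_inj/funext. Qed.

Lemma dcoord_fin (x : F) : finite_set [set i | dcoord i x != 0].
Proof. exact/asboolP/(valP x). Qed.

Lemma dsum_mk (f : T -> R^o) : finite_set [set i | f i != 0] ->
  exists x : F, forall i, dcoord i x = f i.
Proof.
move=> fin; have f_in : f \in fin_supp R T by apply/asboolP.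
by exists (exist _ f f_in).
Qed.

End DirectSum.

Section FreeModule.
Context (R : pzRingType) (T : choiceType).
Local Notation F := (direct_sum R T).

Lemma dbasis_subproof (i : T) :
  (fun j => (i == j)%:R : R^o) \in fin_supp R T.
Proof.
apply/asboolP; apply: (@sub_finite_set _ _ [set i]); last exact: finite_set1.
by move=> j /=; case: (eqVneq i j) => [->//|_]; rewrite eqxx.
Qed.

Definition dbasis (i : T) : F :=
  exist (fun f : T -> R^o => f \in fin_supp R T) _ (dbasis_subproof i).

Lemma dcoord_basis i j : dcoord j (dbasis i) = (i == j)%:R.
Proof. by []. Qed.

Section Lift.
Context (A : lmodType R) (a : T -> A).

Definition dlift (x : F) : A := \sum_(i \in [set: T]) (dcoord i x : R) *: a i.

Lemma dlift_seq (s : seq T) (x : F) : uniq s ->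
  (forall i, dcoord i x != 0 -> i \in s) ->
  dlift x = \sum_(i <- s) (dcoord i x : R) *: a i.
Proof.
move=> us xs; rewrite /dlift (fsbigE s)//.
  by apply: eq_bigl => i; rewrite in_setT.
by move=> i _; apply: contraNeq => h; apply: xs; apply: contraNneq h => ->;
  rewrite scale0r.
Qed.

Lemma dsupp_seq (x y : F) : exists s : seq T,
  [/\ uniq s, forall i, dcoord i x != 0 -> i \in s
  & forall i, dcoord i y != 0 -> i \in s].
Proof.
have fxy : finite_set ([set i | dcoord i x != 0] `|` [set i | dcoord i y != 0]).
  by rewrite finite_setU; split; exact: dcoord_fin.
have /finite_seqP[s es] := fxy; exists (undup s).
have in_s i : (dcoord i x != 0) \/ (dcoord i y != 0) -> i \in undup s.
  by move=> h; rewrite mem_undup; suff : [set` s] i by []; rewrite -es.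
by split=> [|i xi|i yi]; [exact: undup_uniq|apply: in_s; left|apply: in_s; right].
Qed.

Lemma dlift_linear : linear dlift.
Proof.
move=> r x y; have [s [us xs ys]] := dsupp_seq x y.
rewrite !(dlift_seq us)//.
  rewrite scaler_sumr -big_split; apply: eq_bigr => i _ /=.
  by rewrite linearP scalerDl scalerA.
move=> i; have [x0|/xs//] := eqVneq (dcoord i x) 0.
have [y0|/ys//] := eqVneq (dcoord i y) 0.
by rewrite linearP /= x0 y0 scaler0 addr0 eqxx.
Qed.

HB.instance Definition _ := GRing.isLinear.Build R F A _ dlift dlift_linear.

Lemma dlift_basis i : dlift (dbasis i) = a i.
Proof.
rewrite (@dlift_seq [:: i])//.
  by rewrite big_seq1 dcoord_basis eqxx scale1r.
by move=> j; rewrite dcoord_basis inE (eq_sym j); case: (i == j); rewrite ?eqxx.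
Qed.

End Lift.

Lemma dsum_expand (x : F) (s : seq T) : uniq s ->
  (forall i, dcoord i x != 0 -> i \in s) ->
  x = \sum_(i <- s) (dcoord i x : R) *: dbasis i.
Proof.
move=> us xs; apply/dsum_ext => j; rewrite linear_sum /=.
have [js|js] := boolP (j \in s).
  rewrite (big_rem j)//= linearZ /= dcoord_basis eqxx big_seq big1 ?addr0.
    by rewrite /GRing.scale/= mulr1.
  move=> i; rewrite mem_rem_uniq// inE => /andP[ij _].
  by rewrite linearZ /= dcoord_basis (negbTE ij) scaler0.
rewrite big_seq big1 => [|i si].
  by apply/eqP; apply: contraNT js => /xs.
rewrite linearZ /= dcoord_basis; case: eqVneq => [ij|_]; last by rewrite scaler0.
by rewrite -ij si in js.
Qed.

Lemma dlift_eq (A : lmodType R) (h : {linear F -> A}) (x : F) :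
  h x = dlift (h \o dbasis) x.
Proof.
have [s [us xs _]] := dsupp_seq x x.
rewrite (dlift_seq _ us xs) [x in LHS](dsum_expand us xs) linear_sum.
by apply: eq_bigr => i _; rewrite linearZ.
Qed.

Lemma dsum_hom_ext (A : lmodType R) (h k : {linear F -> A}) :
  (forall i, h (dbasis i) = k (dbasis i)) -> forall x, h x = k x.
Proof.
move=> hk x; rewrite (dlift_eq h) (dlift_eq k); congr (dlift _ x).
by apply/funext => i /=.
Qed.

Lemma dsum_projective : projective F.
Proof.
move=> A B g h gs; have /choice[a ga] : forall i, exists y, g y = h (dbasis i).
  by move=> i; apply: gs.
exists (dlift a) => x.
by apply: (@dsum_hom_ext _ (g \o dlift a) h) => i /=; rewrite dlift_basis.
Qed.

End FreeModule.

Arguments dlift {R T A}.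

Section SubmodClosed.
Context (R : pzRingType) (V : lmodType R) (N : submodClosed V).

Lemma submodNr x : x \in N -> - x \in N.
Proof. by move=> xN; rewrite -scaleN1r rpredZ. Qed.

Lemma submodN x : (- x \in N) = (x \in N).
Proof. by apply/idP/idP => /submodNr; rewrite ?opprK. Qed.

Lemma submodB x y : x \in N -> y \in N -> x - y \in N.
Proof. by move=> xN yN; rewrite rpredD ?submodN. Qed.

End SubmodClosed.

(** * Quotient modules *)

(** The quotient is the set of canonical representatives of cosets, so that its
    module laws follow by projecting those of V. *)
Section Quotient.
Context (R : pzRingType) (V : lmodType R) (N : submodClosed V).

Let congN (x : V) : set V := [set y | x - y \in N].

Definition qrepr (x : V) : V := xget 0 (congN x).

Lemma qreprP x : x - qrepr x \in N.
Proof.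
rewrite /qrepr; case: xgetP => [y -> //|/(_ x)[]].
by rewrite /congN/= subrr rpred0.
Qed.

Lemma qrepr_eq x y : x - y \in N -> qrepr x = qrepr y.
Proof.
move=> xyN; have e : congN x = congN y.
  apply/seteqP; split=> z; rewrite /congN/= => h.
    have -> : y - z = (x - z) - (x - y) by rewrite [RHS]addrC opprB addrA subrK.
    exact: submodB.
  have -> : x - z = (x - y) + (y - z) by rewrite addrA subrK.
  exact: rpredD.
by rewrite /qrepr e.
Qed.

Definition quot : Type := {x : V | qrepr x == x}.

HB.instance Definition _ := SubChoice.on quot.

Lemma qrepr_id x : qrepr (qrepr x) == qrepr x.
Proof. by apply/eqP/qrepr_eq; rewrite -opprB submodN qreprP. Qed.

Definition qproj (x : V) : quot := exist _ (qrepr x) (qrepr_id x).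

Lemma qproj_eq x y : x - y \in N -> qproj x = qproj y.
Proof. by move=> /qrepr_eq e; apply: val_inj. Qed.

Lemma qvalK (u : quot) : qproj (val u) = u.
Proof. by apply: val_inj; apply/eqP/(valP u). Qed.

Definition qzero := qproj 0.
Definition qopp (u : quot) := qproj (- val u).
Definition qadd (u v : quot) := qproj (val u + val v).
Definition qscale (r : R) (u : quot) := qproj (r *: val u).

Lemma qval_proj x : val (qproj x) - x \in N.
Proof. by rewrite -opprB submodN qreprP. Qed.

Lemma qaddE x y : qadd (qproj x) (qproj y) = qproj (x + y).
Proof.
by apply: qproj_eq; rewrite opprD addrACA rpredD ?qval_proj.
Qed.

Lemma qoppE x : qopp (qproj x) = qproj (- x).
Proof. by apply: qproj_eq; rewrite -opprD submodN qval_proj. Qed.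

Lemma qscaleE r x : qscale r (qproj x) = qproj (r *: x).
Proof. by apply: qproj_eq; rewrite -scalerBr rpredZ ?qval_proj. Qed.

Lemma qaddA : associative qadd.
Proof.
by move=> u v w; rewrite -(qvalK u) -(qvalK v) -(qvalK w) !qaddE addrA.
Qed.

Lemma qaddC : commutative qadd.
Proof. by move=> u v; rewrite /qadd addrC. Qed.

Lemma qadd0 : left_id qzero qadd.
Proof. by move=> u; rewrite -(qvalK u) qaddE add0r. Qed.

Lemma qaddN : left_inverse qzero qopp qadd.
Proof. by move=> u; rewrite -(qvalK u) qoppE qaddE addNr. Qed.

HB.instance Definition _ :=
  GRing.isZmodule.Build quot qaddA qaddC qadd0 qaddN.

Lemma qscaleA r s u : qscale r (qscale s u) = qscale (r * s) u.
Proof. by rewrite -(qvalK u) !qscaleE scalerA. Qed.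

Lemma qscale1 : left_id 1 qscale.
Proof. by move=> u; rewrite -(qvalK u) qscaleE scale1r. Qed.

Let qplusE x y : qproj x + qproj y = qproj (x + y) := qaddE x y.

Lemma qscaleDr : right_distributive qscale +%R.
Proof.
by move=> r u v; rewrite -(qvalK u) -(qvalK v) qplusE !qscaleE qplusE scalerDr.
Qed.

Lemma qscaleDl u : {morph qscale^~ u : r s / r + s}.
Proof. by move=> r s; rewrite -(qvalK u) !qscaleE qplusE scalerDl. Qed.

HB.instance Definition _ := GRing.Zmodule_isLmodule.Build R quot
  qscaleA qscale1 qscaleDr qscaleDl.

Lemma qproj_linear : linear qproj.
Proof. by move=> r x y; rewrite -qaddE -qscaleE. Qed.

HB.instance Definition _ :=
  GRing.isLinear.Build R V quot _ qproj qproj_linear.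

Lemma qproj_surj : surjective qproj.
Proof. by move=> u; exists (val u); rewrite qvalK. Qed.

Lemma qproj_eq0 x : qproj x = 0 <-> x \in N.
Proof.
split=> [/(congr1 val)/= e|xN]; last by apply: qproj_eq; rewrite subr0.
suff : (x - qrepr x) + qrepr x \in N by rewrite subrK.
apply: rpredD; first exact: qreprP.
by rewrite e; have := qreprP 0; rewrite sub0r submodN.
Qed.

End Quotient.

Section ImageSubmodule.
Context (R : pzRingType) (V W : lmodType R) (h : {linear V -> W}).

Definition im_pred : {pred W} := fun y => `[< exists x, h x = y >].

Lemma im_submod_closed : submod_closed im_pred.
Proof.
split=> [|r x y /asboolP[u <-] /asboolP[v <-]]; apply/asboolP.
  by exists 0; rewrite linear0.
by exists (r *: u + v); rewrite linearP.
Qed.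

HB.instance Definition _ :=
  GRing.isSubmodClosed.Build R W im_pred im_submod_closed.

End ImageSubmodule.

(** * Finitely generated right ideals *)

Lemma mk_linear (R : pzRingType) (V W : lmodType R) (f : V -> W) :
  linear f -> exists g : {linear V -> W}, forall x, g x = f x.
Proof.
move=> fl; pose g : {linear V -> W} := HB.pack f (GRing.isLinear.Build R V W _ f fl).
by exists g.
Qed.

Section LinComb.
Context (R : pzRingType).

(** The recursive form is the one that a string of existential quantifiers
    produces; on R itself it is membership in a finitely generated right ideal,
    because the unknown multipliers stand on the right of the coefficients. *)
Fixpoint lincomb (M : lmodType R) (c : seq R) (z : M) : Prop :=
  if c is r :: c' then exists y : M, lincomb c' (z - r *: y) else z = 0.

Lemma lincombP (M : lmodType R) (c : seq R) (z : M) :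
  lincomb c z <-> exists y : nat -> M, z = \sum_(i < size c) c`_i *: y i.
Proof.
elim: c z => [|r c IH] z /=.
  by split=> [->|[y]]; [exists (fun=> 0)|]; rewrite big_ord0.
split=> [[y /IH[w e]]|[y e]].
  exists (fun n => if n is k.+1 then w k else y).
  by rewrite big_ord_recl /=; apply/eqP; rewrite addrC -subr_eq e.
exists (y 0); apply/IH; exists (fun k => y k.+1).
by rewrite e big_ord_recl /= addrC addKr.
Qed.

Lemma lincomb_ord (M : lmodType R) n (a : 'I_n -> R) (z : M) :
  lincomb [seq a i | i <- enum 'I_n] z <-> exists y : 'I_n -> M, z = \sum_i a i *: y i.
Proof.
have an (i : 'I_n) : [seq a i | i <- enum 'I_n]`_i = a i.
  by rewrite (nth_map i) ?size_enum_ord// nth_ord_enum.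
rewrite lincombP size_map size_enum_ord; split=> [[y ->]|[y ->]].
  by exists (fun i : 'I_n => y i); apply: eq_bigr => i _; rewrite an.
exists (fun i => oapp y 0 (insub i)); apply: eq_bigr => i _.
by rewrite an valK.
Qed.

Definition rspan (c : seq R) : set R := @lincomb R^o c.

Lemma rspanP (c : seq R) (z : R) :
  rspan c z <-> exists y : nat -> R, z = \sum_(i < size c) c`_i * y i.
Proof. exact: lincombP. Qed.

Lemma rspan_nth (c : seq R) i : (i < size c)%N -> rspan c c`_i.
Proof.
move=> ic; apply/rspanP; exists (fun j => (i == j)%:R).
rewrite (bigD1 (Ordinal ic))//= eqxx mulr1 big1 ?addr0// => j ji.
suff -> : (i == j) = false by rewrite mulr0.
by apply: contraNF ji => /eqP e; apply/eqP/val_inj.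
Qed.

Lemma rspan0 c : rspan c 0.
Proof. by apply/rspanP; exists (fun=> 0); rewrite big1// => i _; rewrite mulr0. Qed.

Lemma rspanD c x y : rspan c x -> rspan c y -> rspan c (x + y).
Proof.
move=> /rspanP[u ->] /rspanP[v ->]; apply/rspanP; exists (fun i => u i + v i).
by rewrite -big_split; apply: eq_bigr => i _; rewrite mulrDr.
Qed.

Lemma rspanMr c x r : rspan c x -> rspan c (x * r).
Proof.
move=> /rspanP[u ->]; apply/rspanP; exists (fun i => u i * r).
by rewrite mulr_suml; apply: eq_bigr => i _; rewrite mulrA.
Qed.

Lemma rspan_sum c (J : Type) (s : seq J) (P : pred J) (F : J -> R) :
  (forall i, P i -> rspan c (F i)) -> rspan c (\sum_(i <- s | P i) F i).
Proof.
by move=> h; apply: (big_ind (rspan c)) => //; [exact: rspan0|exact: rspanD].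
Qed.

Lemma rspan_le c d : (forall x, x \in c -> rspan d x) -> rspan c `<=` rspan d.
Proof.
move=> cd x /rspanP[y ->]; apply: rspan_sum => i _.
by apply/rspanMr/cd/mem_nth.
Qed.

Definition fgr_dcc : Prop := forall a : nat -> seq R,
  (forall n, rspan (a n.+1) `<=` rspan (a n)) ->
  exists n, forall m, rspan (a n) `<=` rspan (a m).

(** Stated for an arbitrary family of ideals, so that it yields a least pp
    subgroup as well as a least principal right ideal. *)
Lemma fgr_min (T : Type) (Q : T -> Prop) (s : T -> seq R) : fgr_dcc ->
  (exists t, Q t) -> exists t, Q t /\
    forall u, Q u -> rspan (s u) `<=` rspan (s t) -> rspan (s t) `<=` rspan (s u).
Proof.
move=> dcc [t0 Qt0]; apply: contrapT => none.
have /choice[f fP] : forall t, exists u, Q t -> [/\ Q u,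
    rspan (s u) `<=` rspan (s t) & ~ rspan (s t) `<=` rspan (s u)].
  move=> t; have [Qt|nQt] := pselect (Q t); last by exists t.
  apply: contrapT => nu; apply: none; exists t; split=> // u Qu ut.
  by apply: contrapT => ntu; apply: nu; exists u.
have Qf n : Q (iter n f t0) by elim: n => //= n /fP[].
have [n|n nP] := dcc (fun n => s (iter n f t0)).
  by have [] := fP _ (Qf n).
by have [_ _] := fP _ (Qf n); apply; exact: (nP n.+1).
Qed.

Lemma fgr_strict_chain : ~ fgr_dcc -> exists (b : nat -> seq R) (r : nat -> R),
  (forall m n, (m <= n)%N -> rspan (b n) `<=` rspan (b m)) /\
  forall n, rspan (b n) (r n) /\ ~ rspan (b n.+1) (r n).
Proof.
move=> ndcc; have [a [adesc nstat]] : exists a : nat -> seq R,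
    (forall n, rspan (a n.+1) `<=` rspan (a n)) /\
    ~ exists n, forall m, rspan (a n) `<=` rspan (a m).
  apply: contrapT => na; apply: ndcc => a adesc; apply: contrapT => nstat.
  by apply: na; exists a.
have amono m n : (m <= n)%N -> rspan (a n) `<=` rspan (a m).
  move=> /subnK <-; elim: (n - m)%N => [//|k IH] x; rewrite addSn.
  by move=> /adesc/IH.
have /choice[w wP] : forall n, exists w : nat * R,
    [/\ (n <= w.1)%N, rspan (a n) w.2 & ~ rspan (a w.1) w.2].
  move=> n; apply: contrapT => nw; apply: nstat; exists n => m x nx.
  apply: contrapT => mx; apply: nw; exists (maxn n m, x).
  by split=> //=; [exact: leq_maxl|move=> /(amono _ _ (leq_maxr _ _))].
pose st k := iter k (fun n => (w n).1) 0%N.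
exists (fun k => a (st k)), (fun k => (w (st k)).2).
split=> [m n /subnK <-|n]; last by have [_ ? ?] := wP (st n).
elim: (n - m)%N => [//|k IH] x; rewrite addSn => h.
by apply/IH/(amono _ _ _ _ h); have [] := wP (st (k + m)).
Qed.

End LinComb.

(** * Left perfect rings satisfy the descending chain condition *)

(** The hypothesis on N is flatness of the quotient in Villamayor's form: each
    element of N is killed by an endomorphism inducing the identity on the
    quotient. If f is a projective cover of the quotient and f k = 0, such an
    endomorphism transported along lifts gives an endomorphism e of P with
    f e = f and e k = 0. As the kernel of f is superfluous, e is onto, and so is
    any section of e; hence e is injective and k = 0. So f is an isomorphism and
    the quotient is projective. *)
Lemma perfect_split (R : pzRingType) (T : choiceType)
    (N : submodClosed (direct_sum R T)) : left_perfect R ->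
  (forall y, y \in N -> exists t : {linear direct_sum R T -> direct_sum R T},
      (forall x, t x - x \in N) /\ t y = 0) ->
  exists s : {linear quot N -> direct_sum R T}, forall u, qproj N (s u) = u.
Proof.
move=> perf flatN; have [P [f [Pproj fsurj fsup]]] := perf (quot N).
have [h fh] := @dsum_projective R T _ _ f (qproj N) fsurj.
have [g qg] := Pproj _ _ (qproj N) f (@qproj_surj _ _ N).
have finj k : f k = 0 -> k = 0.
  move=> fk0; have /flatN[t [tid tg0]] : g k \in N by apply/qproj_eq0; rewrite qg.
  have fhtg x : f (h (t (g x))) = f x.
    by rewrite fh -qg; apply: qproj_eq.
  pose e : {linear P -> P} := h \o (t \o g).
  have sup (u : {linear P -> P}) : (forall x, f (u x) = f x) ->
      forall x, exists y, u y = x.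
    move=> fu x; apply/asboolP; apply: (fsup (im_pred u)) => {}x.
    exists (u x), (x - u x); split; first by apply/asboolP; exists x.
      by rewrite /= linearB fu subrr.
    by rewrite addrC subrK.
  have [s es] := Pproj _ _ e idfun (sup e fhtg).
  have fs x : f (s x) = f x by rewrite -(fhtg (s x)) -[h _]/(e (s x)) es.
  have [y yk] := sup s fs k.
  have := es y; rewrite yk /e/= tg0 linear0 => y0.
  by rewrite -yk -y0 linear0.
have /choice[k fk] : forall u, exists x, f x = u by exact: fsurj.
have kf x : k (f x) = x.
  by apply/eqP; rewrite -subr_eq0; apply/eqP/finj; rewrite linearB fk subrr.
have [k' k'k] : exists k' : {linear quot N -> P}, forall x, k' x = k x.
  apply: mk_linear => r u v.
  by rewrite -{1}(fk u) -{1}(fk v) -linearP kf.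
by exists (g \o k') => u; rewrite /= qg k'k fk.
Qed.

Section Bass.
Context (R : pzRingType) (a : nat -> seq R).
Hypothesis adesc : forall n, rspan (a n.+1) `<=` rspan (a n).
Local Notation F := (direct_sum R (nat * nat)%type).

(** Basis elements (n, j) span the n-th stage of the telescope, and this vector
    carries the generators of the n-th ideal as its coordinates. *)
Definition bass_vec (n : nat) : F :=
  \sum_(j < size (a n)) (a n)`_j *: dbasis R (n, j : nat).

(** The transition map of the telescope: the matrices come from writing the
    generators of each ideal through those of the preceding one. *)
Lemma bass_shift : exists D : {linear F -> F},
  (forall n, D (bass_vec n) = bass_vec n.+1) /\
  forall i, exists b : nat -> R, D (dbasis R i) =
    \sum_(l < size (a i.1.+1)) b l *: dbasis R (i.1.+1, l : nat).
Proof.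
have /choice[A hA] : forall n, exists A : nat -> nat -> R, forall l,
    (l < size (a n.+1))%N -> (a n.+1)`_l = \sum_(j < size (a n)) (a n)`_j * A l j.
  move=> n; suff /choice[A hA] : forall l, exists Al : nat -> R,
    (l < size (a n.+1))%N -> (a n.+1)`_l = \sum_(j < size (a n)) (a n)`_j * Al j.
    by exists A.
  move=> l; case: (ltnP l (size (a n.+1))) => [ls|_]; last by exists (fun=> 0).
  by have /adesc/rspanP[y e] := rspan_nth ls; exists y.
exists (dlift (fun i : nat * nat => \sum_(l < size (a i.1.+1))
  A i.1 l i.2 *: dbasis R (i.1.+1, l : nat))); split=> [n|i]; last first.
  by exists (fun l => A i.1 l i.2); rewrite /= dlift_basis.
rewrite /bass_vec linear_sum /=; under eq_bigr do
  rewrite linearZ /= dlift_basis scaler_sumr.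
rewrite /= exchange_big; apply: eq_bigr => l _ /=.
by rewrite hA// scaler_suml; apply: eq_bigr => j _; rewrite scalerA.
Qed.

(** The colimit of the telescope is the cokernel of 1 - D. *)
Lemma bass_stationary : left_perfect R ->
  exists n, forall m, rspan (a n) `<=` rspan (a m).
Proof.
move=> perf; have [D [Dvec Dlevel]] := bass_shift.
pose E : {linear F -> F} := idfun \- D; pose N : submodClosed F := im_pred E.
have DN x : D x - x \in N.
  by rewrite -opprB submodN; apply/asboolP; exists x.
(* [push m] moves all stages below m up to stage m; it induces the identity on
   the colimit. *)
pose push m : {linear F -> F} :=
  dlift (fun i : nat * nat => iter (m - i.1) D (dbasis R i)).
have iterN k x : iter k D x - x \in N.
  elim: k => [|k IH] /=; first by rewrite subrr rpred0.
  by rewrite -(subrK (iter k D x) (D _)) -addrA rpredD.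
have pushN m x : push m x - x \in N.
  have [s [us xs _]] := dsupp_seq x x.
  rewrite /push /= {2}(dsum_expand us xs) (dlift_seq _ us xs) -sumrB rpred_sum// => i _.
  by rewrite -scalerBr rpredZ.
have iterlin k (J : finType) (G : J -> F) :
    iter k D (\sum_l G l) = \sum_l iter k D (G l).
  by elim: k => [//|k IH] /=; rewrite IH linear_sum.
have iterZ k r x : iter k D (r *: x) = r *: iter k D x.
  by elim: k => [//|k IH] /=; rewrite IH linearZ.
have pushD m i : (i.1 < m)%N -> push m (D (dbasis R i)) = push m (dbasis R i).
  move=> im; rewrite /push /= dlift_basis -(subnSK im) iterSr.
  have [b ->] := Dlevel i; rewrite !linear_sum /=.
  rewrite iterlin; apply: eq_bigr => l _.
  by rewrite linearZ /= dlift_basis iterZ.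
have pushN0 y : y \in N -> exists m, push m y = 0.
  move=> /asboolP[w <-]; have [s [us ws _]] := dsupp_seq w w.
  pose m := (\max_(i <- s) i.1).+1; exists m.
  have pD i : i \in s -> push m (D (dbasis R i)) = push m (dbasis R i).
    by move=> si; apply: pushD; rewrite ltnS leq_bigmax_seq.
  move: (push m) pD => p pD; rewrite /E /= /GRing.sub_fun /= linearB.
  apply/eqP; rewrite subr_eq0 (dsum_expand us ws) !linear_sum /=; apply/eqP.
  by apply: eq_big_seq => i si; rewrite !linearZ /= pD.
have [s qs] : exists s : {linear quot N -> F}, forall u, qproj N (s u) = u.
  apply: perfect_split perf _ => y /pushN0[m m0]; exists (push m).
  by split=> // x; exact: pushN.
have qvec n : qproj N (bass_vec n) = qproj N (bass_vec 0).
  elim: n => [//|n <-]; rewrite -Dvec; exact: qproj_eq.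
(* The class of [bass_vec n] does not depend on n, so the coordinates of its
   image z under the section lie in every ideal of the chain. *)
pose z := s (qproj N (bass_vec 0)).
have zspan n i : rspan (a n) (dcoord i z).
  rewrite /z -(qvec n) /bass_vec !linear_sum /=; apply: rspan_sum => j _.
  by rewrite !linearZ /=; apply/rspanMr/rspan_nth.
(* z and [bass_vec 0] agree in the colimit, hence already at a stage m. *)
have /pushN0[m mz] : z - bass_vec 0 \in N.
  by apply/qproj_eq0; rewrite linearB /= /z qs subrr.
have pushvec : push m (bass_vec 0) = bass_vec m.
  have -> : bass_vec m = iter m D (bass_vec 0).
    by elim: (m) => [//|k IH] /=; rewrite -IH Dvec.
  rewrite /bass_vec iterlin linear_sum; apply: eq_bigr => j _.
  by rewrite linearZ iterZ /push /= dlift_basis /= subn0.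
exists m => n; apply: rspan_le => x /(nthP 0)[j js <-].
have -> : (a m)`_j = dcoord (m, j) (push m z).
  have -> : push m z = bass_vec m.
    by rewrite -pushvec; apply/eqP; rewrite -subr_eq0 -linearB mz.
  rewrite /bass_vec linear_sum (bigD1 (Ordinal js))//= big1 => [|i ij].
    by rewrite addr0 linearZ /= dcoord_basis eqxx /GRing.scale/= mulr1.
  rewrite linearZ /= dcoord_basis -pair_eqE /= eqxx /=.
  suff -> : (i == j :> nat) = false by rewrite scaler0.
  by apply: contraNF ij => /eqP e; apply/eqP/val_inj.
move: (push m) => p; have [s' [us zs _]] := dsupp_seq z z.
rewrite (dsum_expand us zs) !linear_sum /=; apply: rspan_sum => i _.
by rewrite !linearZ /=; exact/rspanMr/zspan.
Qed.

End Bass.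

Lemma perfect_dcc (R : pzRingType) : left_perfect R -> fgr_dcc R.
Proof. by move=> perf a adesc; exact: bass_stationary. Qed.

(** * The Jacobson radical under the descending chain condition *)

Section Radical.
Context (R : pzRingType).
Implicit Types a b c e g p q r x y : R.

(** The Jacobson radical. With multipliers on both sides of a, closure under left
    and right multiplication needs no argument. *)
Definition jac a : Prop := forall x y, exists s, (1 - x * a * y) * s = 1.

Lemma jac0 : jac 0.
Proof. by move=> x y; exists 1; rewrite mulr0 mul0r subr0 mulr1. Qed.

Lemma jacMl x a : jac a -> jac (x * a).
Proof.
move=> ja y z; have [s es] := ja (y * x) z; exists s.
by move: es; rewrite !mulrA.
Qed.

Lemma jacMr a y : jac a -> jac (a * y).
Proof.
move=> ja x z; have [s es] := ja x (y * z); exists s.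
by move: es; rewrite !mulrA.
Qed.

Lemma jacD a b : jac a -> jac b -> jac (a + b).
Proof.
move=> ja jb x y; have [s as1] := ja x y; have [t bt1] := jb (s * x) y.
have e : 1 - x * (a + b) * y = (1 - x * a * y) * (1 - s * x * b * y).
  rewrite mulrBr mulr1 !mulrA as1 mul1r.
  by rewrite mulrDr mulrDl opprD addrA.
by exists (t * s); rewrite e -mulrA (mulrA _ t) bt1 mul1r as1.
Qed.

(** With t = x a y, the square of t lies in the radical, and
    1 - t * t = (1 - t) * (1 + t). *)
Lemma jac_semiprime a : (forall r, jac (a * r * a)) -> jac a.
Proof.
move=> h x y; have [s es] := h (y * x) x y.
exists ((1 + x * a * y) * s); rewrite mulrA -[RHS]es; congr (_ * s).
rewrite mulrBl mul1r mulrDr mulr1 opprD addrA addrK.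
by rewrite !mulrA.
Qed.

Definition rdiv a b : Prop := exists r, b = a * r.

Lemma rdiv_trans a b c : rdiv a b -> rdiv b c -> rdiv a c.
Proof. by move=> [r ->] [s ->]; exists (r * s); rewrite mulrA. Qed.

Hypothesis dcc : fgr_dcc R.

Lemma rspan1 a b : rspan [:: a] b <-> rdiv a b.
Proof.
rewrite rspanP; split=> [[y ->]|[r ->]]; last first.
  by exists (fun=> r); rewrite big_ord1.
by exists (y 0); rewrite big_ord1.
Qed.

Lemma rspan1_le a b : rspan [:: b] `<=` rspan [:: a] <-> rdiv a b.
Proof.
split=> [ba|ab x /rspan1 bx]; last exact/rspan1/(rdiv_trans ab).
by apply/rspan1/ba/rspan1; exists 1; rewrite mulr1.
Qed.

Lemma rdiv_min (Q : R -> Prop) a : Q a ->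
  exists b, [/\ Q b, rdiv a b & forall c, Q c -> rdiv b c -> rdiv c b].
Proof.
move=> Qa; pose Qa' b := Q b /\ rdiv a b.
have [|b [[Qb ab] bmin]] := fgr_min (Q := Qa') (fun b => [:: b]) dcc.
  by exists a; split=> //; exists 1; rewrite mulr1.
exists b; split=> // c Qc bc; apply/rspan1_le/bmin; last exact/rspan1_le.
by split=> //; exact: rdiv_trans bc.
Qed.

(** If c n generates the last ideal of the chain then c n = c n * (b * r) with b
    in the radical, and 1 - b * r is right invertible. *)
Lemma jac_Tnilpotent (c : nat -> R) :
  (forall n, exists2 b, jac b & c n.+1 = c n * b) -> exists n, c n = 0.
Proof.
move=> cP; have [n|n nP] := dcc (a := fun n => [:: c n]).
  by apply/rspan1_le; have [b _ ->] := cP n; exists b.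
exists n; have /rspan1_le[r cr] := nP n.+1; have [b jb cb] := cP n.
have [s es] := jb 1 r.
rewrite -[LHS]mulr1 -es mulrA mul1r mulrBr mulr1 mulrA -cb -cr.
by rewrite subrr mul0r.
Qed.

(** Lifting of an idempotent p modulo the nilpotent p * q, where q = 1 - p. The
    step from p to p^2 (1 + 2 q), which is 3 p^2 - 2 p^3, squares the defect
    p * q up to a commuting factor. *)
Lemma idempotent_lift k p q : p + q = 1 -> p * q = q * p ->
  (p * q) ^+ (2 ^ k) = 0 ->
  exists e, [/\ e * e = e, rdiv p e & exists v, e - p = p * q * v].
Proof.
elim: k p q => [|k IH] p q pq1 pqC.
  rewrite expr1 => pq0; exists p; split; last by exists 0; rewrite mulr0 subrr.
    by rewrite -[RHS]mulr1 -pq1 mulrDr pq0 addr0.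
  by exists 1; rewrite mulr1.
move=> nil; pose p' := p * p * (1 + q *+ 2); pose q' := q * q * (1 + p *+ 2).
have cpq : GRing.comm p q by exact: pqC.
have pq1' : p' + q' = 1.
  have cubic : p * p * q + q * q * p = p * q.
    by rewrite -!mulrA -pqC -mulrDl pq1 mul1r.
  rewrite /p' /q' !mulrDr !mulr1.
  rewrite [LHS](AC ((1*2)*(1*2)) ((1*4)*((2*5)*(3*6))))/= !cubic.
  rewrite -[RHS](mulr1 1) -pq1 mulrDl !mulrDr -pqC.
  by rewrite [RHS](AC (2*2) ((1*4)*(2*3))) /=.
have cp : GRing.comm p (1 + q *+ 2).
  by apply: commrD; [exact: commr1|exact: commrMn].
have cq : GRing.comm q (1 + p *+ 2).
  by apply: commrD; [exact: commr1|apply: commrMn; exact: commr_sym].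
have cp2 : GRing.comm p (1 + p *+ 2).
  by apply: commrD; [exact: commr1|exact: commrMn].
have cq2 : GRing.comm q (1 + q *+ 2).
  by apply: commrD; [exact: commr1|exact: commrMn].
have ct : GRing.comm (1 + q *+ 2) (1 + p *+ 2).
  apply: commrD; first exact: commr1.
  by apply: commrMn; exact: commr_sym.
have pqC' : p' * q' = q' * p'.
  have cq' x : GRing.comm x q -> GRing.comm x (1 + p *+ 2) -> GRing.comm x q'.
    by move=> xq xp; apply: commrM xp; exact: commrM.
  apply/commr_sym/commrM; first by apply: commrM; apply/commr_sym/cq'.
  by apply/commr_sym/cq' => //; exact: commr_sym.
have e' : p' * q' = (p * q) ^+ 2 * ((1 + q *+ 2) * (1 + p *+ 2)).
  rewrite /p' /q' !mulrA; congr (_ * _).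
  rewrite -[in LHS](mulrA (p * p)) -(cq2 : _ = _) !mulrA.
  rewrite -[in LHS](mulrA (p * p * q)) -(cq2 : _ = _) !mulrA.
  by rewrite expr2 (mulrA (p * q)) -(mulrA p q p) -pqC !mulrA.
have [|e [ee pe [v ev]]] := IH p' q' pq1' pqC'.
  rewrite e' exprMn_comm; last first.
    have cpqt x : GRing.comm p x -> GRing.comm q x -> GRing.comm ((p * q) ^+ 2) x.
      by move=> px qx; apply/commr_sym/commrX/commrM; exact: commr_sym.
    by apply: commrM; apply: cpqt.
  by rewrite -exprM -expnS nil mul0r.
exists e; split=> //.
  by apply: rdiv_trans pe; exists (p * (1 + q *+ 2)); rewrite mulrA.
exists (p *+ 2 - 1 + p * q * ((1 + q *+ 2) * (1 + p *+ 2)) * v).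
rewrite mulrDr -(subrK p' e) -addrA ev e' addrC; congr (_ + _); last first.
  by rewrite expr2 !mulrA.
have -> : p' - p = p * (p + p * (q *+ 2) - 1).
  by rewrite mulrBr mulr1 mulrDr /p' mulrDr mulr1 !mulrA.
rewrite -mulrA; congr (p * _).
by rewrite mulrBr mulr1 !mulrnAr -pqC -pq1 opprD addrACA subrr add0r.
Qed.

Lemma jac_nilpotent x : jac x -> exists k, x ^+ (2 ^ k) = 0.
Proof.
move=> jx; have [n|n x0] := @jac_Tnilpotent (fun n => x ^+ n).
  by exists x; rewrite // exprSr.
exists n; rewrite -(subnK (ltnW (ltn_expl n (isT : (1 < 2)%N)))) exprD x0.
by rewrite mulr0.
Qed.

(** The last condition makes the left ideal R e simple modulo the radical, in the
    strong form that e itself is recovered and not only its class. *)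
Definition local_idempotent e : Prop :=
  [/\ e * e = e, ~ jac e & forall r, ~ jac (r * e) -> exists s, s * r * e = e].

Lemma jac_semiprimeN a : ~ jac a -> exists r, ~ jac (a * r * a).
Proof.
move=> nja; apply: contrapT => h; apply/nja/jac_semiprime => r.
by apply: contrapT => njr; apply: h; exists r.
Qed.

(** Choose a R minimal among the principal right ideals inside g R but not in J.
    As J is semiprime, a b a is outside J for some b, so by minimality left
    multiplication by c = a b maps c R = a R onto itself. The u with c u = c is
    idempotent modulo the kernel of this map, and the kernel is inside J by
    minimality again. Lifting u gives an idempotent e with e R = a R, and the
    minimality of e R makes e R e a division ring modulo J. *)
Lemma local_idempotent_exists g : ~ jac g ->
  exists e, local_idempotent e /\ rdiv g e.
Proof.
move=> njg; have [a [nja ga amin]] := @rdiv_min (fun x => ~ jac x) g njg.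
have [b njaba] := jac_semiprimeN nja.
have [d ad] : rdiv (a * b * a) a.
  by apply: amin njaba _; exists (b * a); rewrite mulrA.
have [c [u [[b' ac] [w cw] [a' ca] cu]]] :
    exists c u, [/\ rdiv a c, rdiv c u, rdiv c a & c * u = c].
  exists (a * b), (a * b * (a * d * d * b)); split.
  - by exists b.
  - by exists (a * d * d * b).
  - by exists (a * d); rewrite mulrA.
  have e1 : a * b * (a * d) = a by rewrite mulrA -ad.
  by rewrite -(mulrA (a * d)) (mulrA (a * b) (a * d)) e1 (mulrA a d)
    (mulrA (a * b)) e1.
have njc : ~ jac c by move=> jc; apply: nja; rewrite ca; exact: jacMr.
have jx : jac (u * (1 - u)).
  apply: contrapT => njx; have [r xa] : rdiv (u * (1 - u)) a.
    by apply: amin njx _; exists (b' * w * (1 - u)); rewrite cw ac !mulrA.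
  have ca0 : c * a = 0 by rewrite xa !mulrA cu mulrBr mulr1 cu subrr mul0r.
  by apply: njc; rewrite -cu cw mulrA {2}ac mulrA ca0 !mul0r; exact: jac0.
have [k nil] := jac_nilpotent jx.
have [||e [ee [w' ew] [v ev]]] := idempotent_lift _ _ nil.
- by rewrite addrC subrK.
- by rewrite mulrBr mulrBl mulr1 mul1r.
have ae : rdiv a e.
  by exists (b' * w * w'); rewrite ew cw ac !mulrA.
have nje : ~ jac e.
  move=> je; apply: njc; rewrite -cu; apply: jacMl.
  rewrite -[u](subKr e) ev; apply: jacD je _.
  by rewrite -mulrN; exact: jacMr.
have emin x : ~ jac x -> rdiv e x -> rdiv x e.
  move=> njx ex; exact: (rdiv_trans (amin _ njx (rdiv_trans ae ex)) ae).
(* Elements of e R e outside J have right inverses in e R e, hence inverses. *)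
have einv y : ~ jac (e * y * e) -> exists z, e * y * e * z = e /\ e * z * e = z.
  move=> njy; have [|z ez] := emin _ njy; first by exists (y * e); rewrite mulrA.
  exists (e * z * e); rewrite !mulrA ee; split; last by rewrite -(mulrA _ e e) ee.
  by rewrite -(mulrA _ e e) ee -ez.
exists e; split; last exact: rdiv_trans ae.
split=> // r njr; have [t njt] := jac_semiprimeN njr.
have njy : ~ jac (e * (t * r) * e).
  by move=> jy; apply: njt; rewrite -!mulrA; apply: jacMl; rewrite !mulrA in jy *.
have [z [yz eze]] := einv _ njy.
have njz : ~ jac (e * z * e).
  by rewrite eze => jz; apply: nje; rewrite -yz; exact: jacMl.
have [y' [zw ewe]] := einv _ njz; rewrite eze in zw.
exists (z * e * t); suff : z * (e * (t * r) * e) = e by rewrite !mulrA.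
suff <- : y' = e * (t * r) * e by [].
have ey' : e * y' = y' by rewrite -ewe !mulrA ee.
by rewrite -ey' -{1}yz -(mulrA _ z) zw -mulrA ee.
Qed.

End Radical.

(** * Projective covers *)

Section Nakayama.
Context (R : pzRingType) (dcc : fgr_dcc R) (M : lmodType R).

(** The submodule J M. *)
Definition jac_mod : {pred M} := fun z => `[< forall N : submodClosed M,
  (forall a x, jac a -> a *: x \in N) -> z \in N >].

Lemma jac_mod_closed : submod_closed jac_mod.
Proof.
split=> [|r x y /asboolP hx /asboolP hy]; apply/asboolP => N hN.
  exact: rpred0.
by apply: rpredD; [apply/rpredZ/hx|apply: hy].
Qed.

HB.instance Definition _ :=
  GRing.isSubmodClosed.Build R M jac_mod jac_mod_closed.

Lemma jac_modZ a x : jac a -> a *: x \in jac_mod.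
Proof. by move=> ja; apply/asboolP => N; apply. Qed.

(** Nakayama's lemma for arbitrary M. From x outside N with N + J M = M one
    obtains b1 in J and x1 with b1 x1 outside N, then b2 and x2 with b1 b2 x2
    outside N, and so on, against T-nilpotence. *)
Lemma nakayama (N : submodClosed M) :
  (forall x, exists y z, [/\ y \in N, z \in jac_mod & x = y + z]) ->
  forall x, x \in N.
Proof.
move=> NJ x; apply: contrapT => xN.
have step (s : R * M) : exists t : R * M, s.1 *: s.2 \notin N ->
    jac t.1 /\ s.1 *: (t.1 *: t.2) \notin N.
  have [sN|nsN] := boolP (s.1 *: s.2 \in N); first by exists s.
  apply: contrapT => none; move/negP: nsN; apply.
  pose K : {pred M} := fun y => `[< forall r, s.1 *: (r *: y) \in N >].
  have Ksub : submod_closed K.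
    split=> [|r y z /asboolP hy /asboolP hz]; apply/asboolP => q.
      by rewrite !scaler0 rpred0.
    by rewrite !scalerDr [q *: (r *: y)]scalerA; apply: rpredD.
  pose K' : submodClosed M := HB.pack K (GRing.isSubmodClosed.Build R M K Ksub).
  have [y [z [yN /asboolP/(_ K') zK e]]] := NJ s.2.
  have /asboolP/(_ 1) : z \in K'.
    apply: zK => a w ja; apply/asboolP => r; apply: contrapT => nN.
    apply: none; exists (r * a, w) => _ /=; split; first exact: jacMl.
    by apply/negP; rewrite -scalerA.
  by rewrite scale1r e scalerDr => h; rewrite rpredD// rpredZ.
have /choice[f fP] := step.
pose g s := (s.1 * (f s).1, (f s).2).
pose c n := iter n g (1, x).
have cN n : (c n).1 *: (c n).2 \notin N.
  elim: n => [|n IH] /=; first by rewrite scale1r; apply/negP.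
  by have [_] := fP _ IH; rewrite scalerA.
have [n|n c0] := @jac_Tnilpotent R dcc (fun n => (c n).1).
  by exists (f (c n)).1 => //; have [] := fP _ (cN n).
by have /negP := cN n; apply; rewrite c0 scale0r rpred0.
Qed.

End Nakayama.

Lemma retract_projective (R : pzRingType) (F P : lmodType R)
    (q : {linear F -> P}) (i : {linear P -> F}) :
  (forall x, q (i x) = x) -> projective F -> projective P.
Proof.
move=> qi Fproj A B g h gs; have [k gk] := Fproj _ _ g (h \o q) gs.
by exists (k \o i) => x; rewrite gk /= qi.
Qed.

Section Cover.
Context (R : pzRingType) (dcc : fgr_dcc R) (M : lmodType R).
Local Notation T := (R * M)%type.
Local Notation F := (direct_sum R T).

(** The free module on X with R replaced by its summand R e at the index
    t = (e, m). Indices range over all pairs, and X only restricts supports, so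
    that enlarging X does not change the ambient module. *)
Definition idem_supp (X : set T) : {pred F} := fun f =>
  `[< forall t : T, (dcoord t f : R) * t.1 = dcoord t f /\
      ((dcoord t f : R) != 0 -> X t) >].

Lemma idem_supp_closed X : submod_closed (idem_supp X).
Proof.
split=> [|r f g /asboolP hf /asboolP hg]; apply/asboolP => t.
  by rewrite linear0 mul0r eqxx.
have [ft fX] := hf t; have [gt gX] := hg t.
rewrite linearP /= mulrDl gt -[X in X * _ + _]/(r * _) -mulrA ft.
split=> // h; have [f0|] := eqVneq (dcoord t f : R) 0; last exact: fX.
have [g0|] := eqVneq (dcoord t g : R) 0; last exact: gX.
by case/eqP: h; rewrite f0 g0 ?scaler0 ?mulr0 addr0.
Qed.

HB.instance Definition _ X :=
  GRing.isSubmodClosed.Build R F (idem_supp X) (idem_supp_closed X).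

Definition spread : {linear F -> M} := dlift (fun t : T => t.2).

(** Independence modulo J of the elements m, for (e, m) in X. *)
Definition jac_independent (X : set T) : Prop :=
  (forall t, X t -> local_idempotent t.1 /\ t.1 *: t.2 = t.2) /\
  (forall f, f \in idem_supp X -> spread f \in @jac_mod R M ->
     forall t, jac (dcoord t f)).

Lemma jac_independent_max : exists X, jac_independent X /\ forall Y, X `<` Y -> ~ jac_independent Y.
Proof.
apply: Zorn_bigcup => C Cgood Ctot; split=> [t [X CX Xt]|f /asboolP ff fJ t].
  by have [+ _] := Cgood _ CX; apply.
have [s [us fs _]] := dsupp_seq f f.
have [e|/eqP ft0] := eqVneq (dcoord t f : R) 0; first by rewrite e; exact: jac0.
have [X CX sX] : exists2 X, C X &
    forall u, u \in s -> dcoord u f != 0 -> X u.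
  have : exists X, C X by have [_ /(_ (introN eqP ft0))[X CX _]] := ff t; exists X.
  elim: s {us fs} => [[X CX]|u s IH /IH[X CX sX]]; first by exists X.
  have [u0|/eqP u0] := eqVneq (dcoord u f : R) 0.
    exists X => // v; rewrite inE => /orP[/eqP->|]; last exact: sX.
    by rewrite u0 eqxx.
  have [_ /(_ (introN eqP u0))[Y CY Yu]] := ff u.
  have [XY|YX] := Ctot _ _ CX CY.
    exists Y => // v; rewrite inE => /orP[/eqP->//|vs v0]; apply: XY.
    exact: sX.
  by exists X => // v; rewrite inE => /orP[/eqP-> _|]; [exact: YX|exact: sX].
have [_ /(_ f _ fJ)] := Cgood _ CX; apply.
apply/asboolP => u; have [-> _] := ff u; split=> // u0.
by apply: sX => //; exact: fs.
Qed.

Section Max.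
Context (X : set T) (Xgood : jac_independent X).
Hypothesis Xmax : forall Y, X `<` Y -> ~ jac_independent Y.

(* Membership in the submodule generated by J M and the elements m of X. *)
Let reached m := exists f, f \in idem_supp X /\ m - spread f \in @jac_mod R M.

Let reachedP r x y : reached x -> reached y -> reached (r *: x + y).
Proof.
move=> [f [fX xf]] [g [gX yg]]; exists (r *: f + g).
split; first by apply: rpredD => //; apply: rpredZ.
rewrite linearP opprD addrACA -scalerBr; apply: rpredD => //; exact: rpredZ.
Qed.

Let reachedJ x : x \in @jac_mod R M -> reached x.
Proof. by move=> xJ; exists 0; rewrite linear0 subr0 rpred0. Qed.

Let reached_spread f : f \in idem_supp X -> reached (spread f).
Proof. by move=> fX; exists f; rewrite subrr rpred0. Qed.

(** Otherwise the index (e, e m) could be added to X: in a relation, its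
    coefficient r e must lie in J, since s r e = e would put e m in the
    submodule already reached. *)
Lemma max_idem e m : local_idempotent e -> reached (e *: m).
Proof.
move=> eloc; have [ee nje einv] := eloc; apply: contrapT => nr.
pose t0 : T := (e, e *: m).
have em' : e *: (e *: m) = e *: m by rewrite scalerA ee.
have nXt0 : ~ X t0.
  move=> Xt0; apply: nr; rewrite -em' -[e *: m in X in reached X]/(t0.2).
  rewrite -(dlift_basis (fun t : T => t.2) t0) -linearZ.
  apply: (@reached_spread (e *: dbasis R t0)).
  apply/asboolP => t; rewrite [dcoord _ _](_ : _ = e * (t0 == t)%:R)//.
  case: (eqVneq t0 t) => [<-|_]; last by rewrite mulr0 mul0r eqxx.
  by rewrite mulr1 /=.
apply: (Xmax (Y := X `|` [set t0])).
  by split=> [t Xt|/(_ t0)]; [left|move=> h; apply/nXt0/h; right].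
have [Xloc Xind] := Xgood.
split=> [t [/Xloc//|->]|f /asboolP ff fJ]; first by [].
pose r0 : R := dcoord t0 f; pose f' := f - r0 *: dbasis R t0.
have f't0 : dcoord t0 f' = 0.
  by rewrite linearB -[X in _ - X]/(r0 * (t0 == t0)%:R) eqxx mulr1 subrr.
have f't t : t != t0 -> dcoord t f' = dcoord t f.
  move=> tt0; rewrite linearB -[X in _ - X]/(r0 * (t0 == t)%:R) eq_sym.
  by rewrite (negbTE tt0) mulr0 subr0.
have f'X : f' \in idem_supp X.
  apply/asboolP => t; have [->|tt0] := eqVneq t t0.
    by rewrite f't0 mul0r eqxx.
  rewrite f't//; have [ft fX] := ff t; split=> // /fX[//|/= e'].
  by rewrite e' eqxx in tt0.
have spf : spread f = r0 *: (e *: m) + spread f'.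
  by rewrite linearB linearZ /= dlift_basis addrC subrK.
have r0e : r0 * e = r0 by have [] := ff t0.
have jr0 : jac r0.
  rewrite -r0e; apply: contrapT => /einv[s ese]; apply: nr.
  have -> : e *: m = (- s) *: spread f' + s *: spread f.
    by rewrite spf scalerDr !scalerA mulrA ese addrC scaleNr addrK.
  apply: reachedP; first exact: reached_spread.
  by apply/reachedJ/rpredZ.
move=> t; have [->//|tt0] := eqVneq t t0; rewrite -f't//.
apply: Xind => //; have -> : spread f' = spread f - r0 *: (e *: m).
  by rewrite spf addrC addKr.
by apply: submodB => //; exact: jac_modZ.
Qed.

(** Choose g with g R minimal such that (1 - g) m is reached. If g were outside
    J, there would be a local idempotent e in g R, and g - e g would be
    strictly smaller. So g is in J, and so g m is in J M. *)
Lemma max_reached m : reached m.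
Proof.
have reachedD x y : reached x -> reached y -> reached (x + y).
  by move=> rx ry; rewrite -[x]scale1r; exact: reachedP.
pose Q g := reached ((1 - g) *: m).
have Q1 : Q 1 by rewrite /Q subrr scale0r; apply/reachedJ/rpred0.
have [g [Qg _ gmin]] := rdiv_min dcc Q1.
have [jg|njg] := pselect (jac g).
  have -> : m = (1 - g) *: m + g *: m by rewrite -scalerDl subrK scale1r.
  by apply: reachedD => //; exact/reachedJ/jac_modZ.
have [e [eloc [w ew]]] := local_idempotent_exists dcc njg.
have [ee nje _] := eloc; case: nje.
have Qg' : Q (g - e * g).
  rewrite /Q opprB addrCA addrC scalerDl -scalerA; apply: reachedD => //.
  exact: max_idem.
have [|z gz] := gmin _ Qg'.
  by exists (1 - w * g); rewrite mulrBr mulr1 mulrA -ew.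
suff -> : e = 0 by exact: jac0.
by rewrite -ee {2}ew gz !mulrA mulrBr mulrA ee subrr !mul0r.
Qed.

Let P : lmodType R := submod_of (idem_supp X).

Let inc : {linear P -> F} := \val.

Let proj : exists q : {linear F -> P}, (forall p, q (inc p) = p) /\
  forall t, X t -> inc (q (dbasis R t)) = t.1 *: dbasis R t.
Proof.
have [Xloc _] := Xgood.
have /choice[eps epsE] : forall t : T, exists p : P,
    X t -> inc p = t.1 *: dbasis R t.
  move=> t; have [Xt|nXt] := pselect (X t); last by exists 0.
  suff h : t.1 *: dbasis R t \in idem_supp X by exists (exist (fun f => f \in idem_supp X) _ h).
  have [[tt _ _] _] := Xloc t Xt.
  apply/asboolP => u; rewrite [dcoord _ _](_ : _ = t.1 * (t == u)%:R)//.
  case: (eqVneq t u) => [<-|_]; last by rewrite mulr0 mul0r eqxx.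
  by rewrite mulr1.
have [q qE] : exists q : {linear F -> P}, forall t, q (dbasis R t) = eps t.
  by exists (dlift eps) => t; exact: dlift_basis.
exists q; split=> [p|t Xt]; last by rewrite qE epsE.
apply: val_inj; have [s [us ps _]] := dsupp_seq (inc p) (inc p).
rewrite -[RHS]/(inc p) -[LHS]/(inc _) [in RHS](dsum_expand us ps).
rewrite [in LHS](dsum_expand us ps) !linear_sum; apply: eq_bigr => t _.
rewrite linearZ qE linearZ -[LHS]/(_ *: inc (eps t)).
have [p0|/eqP p0] := eqVneq (dcoord t (inc p) : R) 0; first by rewrite p0 !scale0r.
have /asboolP/(_ t)[pt /(_ (introN eqP p0)) Xt] := valP p.
by rewrite epsE// scalerA pt.
Qed.

(** Nakayama's lemma is used twice: in M for surjectivity, and in P to see that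
    the kernel, whose coordinates lie in J by independence, is superfluous. *)
Lemma idem_supp_cover : exists f : {linear P -> M}, projective_cover f.
Proof.
have [q [qi qX]] := proj; exists (spread \o inc); split.
- by apply: retract_projective qi _; exact: dsum_projective.
- move=> m; apply/asboolP; apply: (nakayama dcc (N := im_pred (spread \o inc))).
  move=> {}m; have [f [fX mf]] := max_reached m.
  exists (spread f), (m - spread f); split=> //; last by rewrite addrC subrK.
  by apply/asboolP; exists (exist (fun f => f \in idem_supp X) f fX).
move=> N NK; apply: (nakayama dcc (N := N)) => p.
have [y [z [yN zK e]]] := NK p; exists y, z; split=> //.
have [_ Xind] := Xgood.
have zJ t : jac (dcoord t (inc z)).
  apply: Xind; [exact: valP|have -> : spread (inc z) = 0 := zK; exact: rpred0].
have [s [us zs _]] := dsupp_seq (inc z) (inc z).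
rewrite -(qi z) (dsum_expand us zs) linear_sum rpred_sum// => t _.
by rewrite linearZ; apply: (@jac_modZ _ P (dcoord t (inc z))); exact: zJ.
Qed.

End Max.

End Cover.

Lemma dcc_perfect (R : pzRingType) : fgr_dcc R -> left_perfect R.
Proof.
move=> dcc M; have [X [Xgood Xmax]] := jac_independent_max M.
by have [f fP] := idem_supp_cover dcc Xgood Xmax; exists _, f.
Qed.

(** * Coherence and syzygies *)

Section LeftCoherence.
Context (S : pzRingType).

Definition lsyz_fg : Prop := forall n (a : 'I_n -> S),
  exists m (k : 'I_m -> 'I_n -> S), forall u : 'I_n -> S,
    \sum_i u i * a i = 0 <-> exists r, forall i, u i = \sum_j r j * k j i.

Definition left_coherent : Prop := forall J : submodClosed S^o,
  finitely_generated (submod_of J) -> finitely_presented (submod_of J).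

Lemma lsyz_fg_coherent : lsyz_fg -> left_coherent.
Proof.
move=> syz J [n [a agen]]; have [m [k kP]] := syz n (fun i => \val (a i)).
pose f (u : 'rV[S]_n) : submod_of J := \sum_i u 0 i *: a i.
have flin : linear f.
  move=> r u v; rewrite /f scaler_sumr -big_split; apply: eq_bigr => i _ /=.
  by rewrite !mxE scalerDl scalerA.
have [f' f'E] := mk_linear flin.
exists n, m, f', (mulmxr (\matrix_(j, i) k j i)); split=> [x|u].
  have [c xc] := agen x; exists (\row_i c i); rewrite f'E xc.
  by apply: eq_bigr => i _; rewrite mxE.
have fu : f' u = 0 <-> \sum_i u 0 i * \val (a i) = 0.
  rewrite f'E; split=> [/(congr1 \val)|e].
    by rewrite /f linear_sum.
  by apply: val_inj; rewrite /f linear_sum.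
rewrite fu kP; split=> [[r ur]|[v <-]]; last first.
  by exists (v 0) => i; rewrite !mxE; apply: eq_bigr => j _; rewrite mxE.
exists (\row_j r j); apply/rowP => i; rewrite ur !mxE.
by apply: eq_bigr => j _; rewrite !mxE.
Qed.

(** Schanuel's argument: a presentation of the ideal by other generators is
    translated to the generators a. The rows of X express the a through the new
    generators, those of C the new generators through the a, and those of G
    generate the relations between the new generators. *)
Lemma coherent_lsyz_fg : left_coherent -> lsyz_fg.
Proof.
move=> coh n a; pose A : 'cV[S]_n := \col_i a i.
pose sp (u : 'rV[S]_n) : S^o := (u *m A) 0 0.
have splin : linear sp.
  by move=> r u v; rewrite /sp mulmxDl -scalemxAl !mxE.
have [s sE] := mk_linear splin.
have inJ u : s u \in im_pred s by apply/asboolP; exists u.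
pose el u : submod_of (im_pred s) := exist (fun y => y \in im_pred s) _ (inJ u).
have valel u : \val (el u) = s u by [].
have [|n' [m [f [g [fsurj fker]]]]] := coh (im_pred s).
  exists n, (fun i => el (delta_mx 0 i)) => x.
  have /asboolP[u ux] := valP x; exists (u 0); apply: val_inj.
  rewrite linear_sum /= -ux [u in LHS]row_sum_delta linear_sum.
  by apply: eq_bigr => i _; rewrite !linearZ.
have /choice[c fc] : forall i : 'I_n', exists c : 'rV_n,
    el c = f (delta_mx 0 i).
  move=> i; have /asboolP[u ux] := valP (f (delta_mx 0 i)).
  by exists u; apply: val_inj.
have /choice[x fx] : forall i : 'I_n, exists x, f x = el (delta_mx 0 i).
  by move=> i; exact: fsurj.
pose C := \matrix_i c i; pose X := \matrix_i x i.
pose G := \matrix_i g (delta_mx 0 i).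
have fE u : \val (f u) = s (u *m C).
  rewrite [u in LHS]row_sum_delta !linear_sum mulmx_sum_row linear_sum.
  by apply: eq_bigr => i _; rewrite !linearZ /= -fc rowK.
have gE v : g v = v *m G.
  rewrite [v in LHS]row_sum_delta linear_sum mulmx_sum_row.
  by apply: eq_bigr => i _; rewrite linearZ /= rowK.
have sXC u : s (u *m X *m C) = s u.
  rewrite -fE [u in RHS]row_sum_delta mulmx_sum_row !linear_sum.
  by apply: eq_bigr => i _; rewrite !linearZ /= rowK fx.
pose K := col_mx (G *m C) (1%:M - X *m C).
exists (m + n)%N, (fun j i => K j i) => u.
pose v := \row_i u i.
have -> : \sum_i u i * a i = s v.
  by rewrite sE /sp mxE; apply: eq_bigr => i _; rewrite !mxE.
have -> : (exists r, forall i, u i = \sum_j r j * K j i) <->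
    exists w, v = w *m K.
  split=> [[r ur]|[w vw]].
    exists (\row_j r j); apply/rowP => i; rewrite !mxE ur.
    by apply: eq_bigr => j _; rewrite mxE.
  by exists (w 0) => i; have /rowP/(_ i) := vw; rewrite !mxE.
split=> [sv|[w ->]].
  have /fker[w gw] : f (v *m X) = 0 by apply: val_inj; rewrite fE sXC sv.
  exists (row_mx w v); rewrite mul_row_col mulmxA -gE gw mulmxBr mulmx1.
  by rewrite mulmxA addrC subrK.
rewrite -[w]hsubmxK mul_row_col linearD /= mulmxA -fE -gE.
have -> : f (g (lsubmx w)) = 0 by apply/fker; exists (lsubmx w).
by rewrite mulmxBr mulmx1 linearB /= mulmxA sXC subrr addr0.
Qed.

End LeftCoherence.

Section FinGenRight.
Context (R : pzRingType).

(** Finitely generated right submodules of the free right module of rank n. *)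
Definition fgr n (K : set ('I_n -> R)) : Prop :=
  exists m (k : 'I_m -> 'I_n -> R), forall e,
    K e <-> exists r, forall i, e i = \sum_j k j i * r j.

Definition rsyz_fg : Prop := forall n (a : 'I_n -> R),
  fgr [set u | \sum_i a i * u i = 0].

(** Left modules over the converse ring: both sides are the left-handed
    statement with the products of R read backwards. *)
Lemma right_coherentP : right_coherent R <-> rsyz_fg.
Proof.
split=> [/coherent_lsyz_fg//|syz]; apply: lsyz_fg_coherent => n a; exact: syz.
Qed.

End FinGenRight.

(** * Positive primitive formulas *)

Section PositivePrimitive.
Context (R : pzRingType) (C : Type).

Fixpoint pp n (f : mformula R C n) : Prop :=
  match f with
  | FEq _ _ => True
  | FNot _ => False
  | FAnd g h => pp g /\ pp h
  | FEx g => pp g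
  end.

Lemma env_cons_comp (M N : Type) (h : M -> N) n x (e : 'I_n -> M) :
  h \o env_cons x e = env_cons (h x) (h \o e).
Proof. by apply/funext => i; rewrite /env_cons /=; case: (unlift ord0 i). Qed.

Section Hom.
Context (M N : lmodType R) (h : {linear M -> N}).

Lemma teval_hom (c : C -> M) n (e : 'I_n -> M) t :
  h (teval c e t) = teval (h \o c) (h \o e) t.
Proof.
elim: t => //= [|t <-|t <- u <-|r t <-].
- exact: linear0.
- exact: linearN.
- exact: linearD.
- exact: linearZ.
Qed.

Lemma pp_hom (c : C -> M) n (e : 'I_n -> M) f : pp f ->
  satisfies c e f -> satisfies (h \o c) (h \o e) f.
Proof.
elim: f e => [{}n t u|//|{}n f IHf g IHg|{}n f IHf] e /=.
- by move=> _ tu; rewrite -!teval_hom tu.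
- by move=> [pf pg] [/(IHf _ pf) ? /(IHg _ pg) ?].
by move=> pf [x /(IHf _ pf)]; rewrite env_cons_comp => hx; exists (h x).
Qed.

End Hom.

Section Module.
Context (M : lmodType R).
Implicit Types c d : C -> M.

Lemma teval_sub c d n (e e' : 'I_n -> M) t :
  teval (fun a => c a - d a) (fun i => e i - e' i) t =
  teval c e t - teval d e' t.
Proof.
elim: t => //= [|t ->|t -> u ->|r t ->].
- by rewrite subrr.
- by rewrite opprD.
- by rewrite opprD addrACA.
- by rewrite scalerBr.
Qed.

Lemma env_cons_sub n (x y : M) (e e' : 'I_n -> M) :
  env_cons (x - y) (fun i => e i - e' i) =
  (fun i => env_cons x e i - env_cons y e' i).
Proof. by apply/funext => i; rewrite /env_cons; case: (unlift ord0 i). Qed.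

Lemma pp_sub c d n (e e' : 'I_n -> M) f : pp f ->
  satisfies c e f -> satisfies d e' f ->
  satisfies (fun a => c a - d a) (fun i => e i - e' i) f.
Proof.
elim: f e e' => [{}n t u|//|{}n f IHf g IHg|{}n f IHf] e e' /=.
- by move=> _ ce de; rewrite !teval_sub ce de.
- by move=> [pf pg] [? ?] [? ?]; split; [exact: IHf|exact: IHg].
move=> pf [x cx] [y dy]; exists (x - y); rewrite env_cons_sub.
exact: IHf.
Qed.

(** Evaluation with all constants read as 0, that is, of the homogeneous formula
    associated with f. *)
Definition holds0 n (e : 'I_n -> M) (f : mformula R C n) : Prop :=
  satisfies (fun=> 0) e f.

Lemma env_cons0 n :
  env_cons (0 : M) (fun=> 0 : M) = (fun=> 0) :> ('I_n.+1 -> M).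
Proof. by apply/funext => i; rewrite /env_cons; case: (unlift ord0 i). Qed.

Lemma teval0 n (t : mterm R C n) : teval (fun=> 0) (fun=> 0) t = 0 :> M.
Proof.
by elim: t => //= [t ->|t -> u ->|r t ->]; rewrite ?oppr0 ?addr0 ?scaler0.
Qed.

Lemma pp_zero n (f : mformula R C n) : pp f -> holds0 (fun=> 0 : M) f.
Proof.
elim: f => [{}n t u|//|{}n f IHf g IHg|{}n f IHf] /=.
- by rewrite /holds0 /= !teval0.
- by move=> [/IHf ? /IHg ?].
by move=> /IHf h; exists 0; rewrite env_cons0.
Qed.

(** The solutions of a pp formula form a coset of the solution group of the
    associated homogeneous formula. *)
Lemma pp_diff c n (e e' : 'I_n -> M) (f : mformula R C n) : pp f -> satisfies c e f ->
  satisfies c e' f <-> holds0 (fun i => e' i - e i) f.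
Proof.
move=> pf ce; split=> [ce'|de].
  rewrite /holds0 (_ : (fun=> 0) = fun a => c a - c a); first exact: pp_sub.
  by apply/funext => a; rewrite subrr.
have ne : holds0 (fun i => 0 - (e' i - e i)) f.
  rewrite /holds0 (_ : (fun=> 0) = fun a => (fun=> 0 : M) a - 0).
    exact/(pp_sub pf _ de)/pp_zero.
  by apply/funext => a; rewrite subr0.
rewrite (_ : c = fun a => c a - (fun=> 0 : M) a); last first.
  by apply/funext => a; rewrite subr0.
rewrite (_ : e' = fun i => e i - (0 - (e' i - e i))); first exact: pp_sub.
by apply/funext => i; rewrite sub0r opprK addrC subrK.
Qed.

End Module.

(** A pp definable subgroup of R, as a left module over itself; it is a right
    ideal, because right multiplications are endomorphisms of that module. *)
Definition ppR n (f : mformula R C n.+1) : set R :=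
  [set x | holds0 (env_cons (x : R^o) (fun=> 0)) f].

Section DirectSum.
Context (I : Type).
Local Notation F := (direct_sum R I).

(** Only the existential quantifier is at stake: witnesses are chosen coordinate
    by coordinate, and they have finite support once 0 is chosen wherever all
    the arguments vanish. *)
Lemma pp_dsum n (e : 'I_n -> F) f : pp f ->
  holds0 e f <-> forall i, holds0 (fun k => dcoord i (e k)) f.
Proof.
move=> pf; split=> [he i|].
  by have := pp_hom (dcoord i) pf he; rewrite (_ : _ \o _ = fun=> 0)//;
     apply/funext => a /=; exact: linear0.
elim: f pf e => [{}n t u|//|{}n f IHf g IHg|{}n f IHf] /=.
- move=> _ e h; apply: dsum_ext => i; rewrite !teval_hom.
  have := h i; rewrite /holds0 /=.
  by rewrite (_ : (fun=> 0) = dcoord i \o (fun=> 0 : F)).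
- move=> [pf pg] e h; split; [apply: IHf => //|apply: IHg => //] => i.
    by have [] := h i.
  by have [] := h i.
move=> pf e h.
have /choice[x xP] : forall i, exists x : R^o,
    holds0 (env_cons x (fun k => dcoord i (e k))) f /\
    ((forall k, dcoord i (e k) = 0) -> x = 0).
  move=> i; have [e0|ne0] := pselect (forall k, dcoord i (e k) = 0).
    exists 0; split=> //; rewrite (_ : (fun k => _) = fun=> 0).
      by rewrite env_cons0; exact: pp_zero.
    by apply/funext.
  by have [x hx] := h i; exists x.
have [y yx] : exists y : F, forall i, dcoord i y = x i.
  apply: dsum_mk; apply: (@sub_finite_set _ _
    (\bigcup_(k in [set: 'I_n]) [set i | dcoord i (e k) != 0])).
    move=> i /= xi; apply: contrapT => nk; case/eqP: xi.
    have [_ ->//] := xP i; move=> k; apply/eqP; apply: contrapT => ek.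
    by apply: nk; exists k => //=; apply/negP.
  apply: bigcup_finite; first exact: finite_finset.
  by move=> k _; exact: dcoord_fin.
exists y; apply: IHf => // i; have [+ _] := xP i; rewrite -yx.
by rewrite (_ : env_cons _ _ = fun k => dcoord i (env_cons y e k))//;
   rewrite -[RHS]/(dcoord i \o env_cons y e) env_cons_comp.
Qed.

End DirectSum.

End PositivePrimitive.

(** * Solutions of pp formulas over right coherent rings *)

Section FinGenSubmodules.
Context (R : pzRingType) (syz : rsyz_fg R).

Lemma fgr_ext n (K L : set ('I_n -> R)) : (forall e, K e <-> L e) -> fgr K -> fgr L.
Proof. by move=> KL [m [k kP]]; exists m, k => e; rewrite -KL. Qed.

(** Writing e = sum_j k_j r_j turns the equation into a syzygy on the r_j. *)
Lemma fgr_lin n (K : set ('I_n -> R)) (c : 'I_n -> R) : fgr K ->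
  fgr [set e | K e /\ \sum_i c i * e i = 0].
Proof.
move=> [m [k kP]]; have [p [l lP]] := syz (fun j => \sum_i c i * k j i).
have comb r : \sum_i c i * (\sum_j k j i * r j) =
    \sum_j (\sum_i c i * k j i) * r j.
  under eq_bigr do rewrite mulr_sumr.
  rewrite exchange_big; apply: eq_bigr => j _ /=; rewrite mulr_suml.
  by apply: eq_bigr => i _; rewrite mulrA.
exists p, (fun q i => \sum_j k j i * l q j) => e.
have assoc r i : \sum_q (\sum_j k j i * l q j) * r q =
    \sum_j k j i * (\sum_q l q j * r q).
  under eq_bigr do rewrite mulr_suml.
  rewrite exchange_big; apply: eq_bigr => j _ /=; rewrite mulr_sumr.
  by apply: eq_bigr => q _; rewrite mulrA.
split=> [[/kP[r er] ce]|[r er]].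
  have /lP[q rq] : \sum_j (\sum_i c i * k j i) * r j = 0.
    by rewrite -comb -[RHS]ce; apply: eq_bigr => i _; rewrite er.
  exists q => i; rewrite assoc er; by apply: eq_bigr => j _; rewrite rq.
have e' i : e i = \sum_j k j i * (\sum_q l q j * r q) by rewrite er assoc.
split; first by apply/kP; eexists => i; exact: e'.
under eq_bigr do rewrite e'; rewrite comb; apply/lP; by exists r.
Qed.

Lemma fgr_proj n (K : set ('I_n.+1 -> R)) : fgr K ->
  fgr [set e | exists x, K (env_cons x e)].
Proof.
move=> [m [k kP]]; exists m, (fun j i => k j (lift ord0 i)) => e.
split=> [[x /kP[r er]]|[r er]].
  by exists r => i; rewrite -er /env_cons liftK.
exists (\sum_j k j ord0 * r j); apply/kP; exists r => i.
by case: (unliftP ord0 i) => [j ->|->]; rewrite /env_cons ?liftK ?unlift_none /= ?er.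
Qed.

Lemma fgr_cyl n (K : set ('I_n -> R)) : fgr K ->
  fgr [set e : 'I_n.+1 -> R | K (fun i => e (lift ord0 i))].
Proof.
move=> [m [k kP]].
exists m.+1, (fun j => if unlift ord0 j is Some j' then env_cons 0 (k j')
                       else env_cons 1 (fun=> 0)) => e.
split=> [/kP[r er]|[r er]].
  exists (env_cons (e ord0) r) => i.
  rewrite big_ord_recl unlift_none.
  under eq_bigr do rewrite liftK /env_cons liftK /=.
  case: (unliftP ord0 i) => [j ->|->]; rewrite /env_cons ?liftK ?unlift_none /=.
    by rewrite mul0r add0r er.
  by rewrite mul1r big1 ?addr0// => j _; rewrite mul0r.
apply/kP; exists (fun j => r (lift ord0 j)) => i.
rewrite er big_ord_recl unlift_none /env_cons liftK /= mul0r add0r.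
by apply: eq_bigr => j _; rewrite !liftK.
Qed.

Section Formulas.
Context (C : Type).

Definition tcoef n (t : mterm R C n) (i : 'I_n) : R :=
  teval (M := R^o) (fun=> 0) (fun j => (i == j)%:R) t.

Lemma teval_coef n (e : 'I_n -> R^o) (t : mterm R C n) :
  teval (fun=> 0) e t = \sum_i tcoef t i * e i.
Proof.
rewrite /tcoef; elim: t => /= [j|a||t ->|t -> u ->|r t ->].
- rewrite (bigD1 j)//= eqxx mul1r big1 ?addr0// => i /negbTE ->.
  by rewrite mul0r.
- by rewrite big1// => i _; rewrite mul0r.
- by rewrite big1// => i _; rewrite mul0r.
- by rewrite -sumrN; apply: eq_bigr => i _; rewrite mulNr.
- by rewrite -big_split; apply: eq_bigr => i _; rewrite /= mulrDl.
rewrite scaler_sumr; apply: eq_bigr => i _.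
by rewrite -[RHS]mulrA.
Qed.

(** Intersecting with an arbitrary K, rather than describing the solution set
    alone, lets the induction treat conjunctions one factor at a time. *)
Lemma fgr_pp n (f : mformula R C n) : pp f -> forall K : set ('I_n -> R),
  fgr K -> fgr [set e : 'I_n -> R | K e /\ holds0 (e : 'I_n -> R^o) f].
Proof.
elim: f => [{}n t u|//|{}n f IHf g IHg|{}n f IHf] /=.
- move=> _ K /(@fgr_lin _ _ (fun i => tcoef t i - tcoef u i)).
  apply: fgr_ext => e; rewrite /holds0 /= !teval_coef.
  split=> -[Ke h]; split=> //.
    apply/eqP; rewrite -subr_eq0 -sumrB -[X in _ == X]h; apply/eqP.
    by apply: eq_bigr => i _; rewrite mulrBl.
  by under eq_bigr do rewrite mulrBl; rewrite sumrB h subrr.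
- move=> [pf pg] K /(IHf pf)/(IHg pg).
  apply: fgr_ext => e; rewrite /holds0 /=.
  by split=> [[[? ?] ?]|[? [? ?]]].
move=> pf K /fgr_cyl/(IHf pf)/fgr_proj; apply: fgr_ext => e; rewrite /holds0 /=.
have eK x : (fun i => env_cons x e (lift ord0 i)) = e.
  by apply/funext => i; rewrite /env_cons liftK.
split=> [[x [+ h]]|[Ke [x h]]]; first by rewrite eK => ?; split=> //; exists x.
by exists x; rewrite eK.
Qed.

Lemma ppR_fg n (f : mformula R C n.+1) : pp f -> exists a, ppR f = rspan a.
Proof.
move=> pf; have f0 : fgr [set e : 'I_n -> R | e = fun=> 0].
  exists 0%N, (fun _ _ => 0) => e; split=> [->|[r er]].
    by exists (fun=> 0) => i; rewrite big_ord0.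
  by apply/funext => i; rewrite er big_ord0.
have [m [k kP]] := fgr_pp pf (fgr_cyl f0).
exists [seq k j ord0 | j <- enum 'I_m].
have spanE x : rspan [seq k j ord0 | j <- enum 'I_m] x <->
    exists r, x = \sum_j k j ord0 * r j.
  exact: lincomb_ord.
apply/seteqP; split=> x; rewrite spanE /ppR /=.
  move=> fx; have [+ _] := kP (env_cons x (fun=> 0)); case=> [|r er].
    by split=> //=; apply/funext => i; rewrite /env_cons liftK.
  by exists r; rewrite -er /env_cons unlift_none.
move=> [r xr]; have [_] := kP (fun i => \sum_j k j i * r j).
move=> [|e0 h]; first by exists r.
rewrite (_ : env_cons _ _ = fun i => \sum_j k j i * r j)//.
apply/funext => i; case: (unliftP ord0 i) => [j ->|->].
  by rewrite /env_cons liftK /=; have /(congr1 (fun g => g j)) := e0.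
by rewrite /env_cons unlift_none.
Qed.

End Formulas.
End FinGenSubmodules.

Section Ideal.
Context (R : pzRingType) (C : Type) (n : nat) (f : mformula R C n.+1).
Hypothesis pf : pp f.

Lemma ppR0 : ppR f 0.
Proof. by rewrite /ppR /= env_cons0; exact: pp_zero. Qed.

Lemma ppRB x y : ppR f x -> ppR f y -> ppR f (x - y).
Proof.
move=> fx fy; have := pp_sub pf fx fy; rewrite -env_cons_sub.
have sub0 (T : Type) : (fun=> 0 - 0 : R^o) = (fun=> 0) :> (T -> R^o).
  by apply/funext => i; rewrite subrr.
by rewrite 2!sub0.
Qed.

Lemma ppRMr x r : ppR f x -> ppR f (x * r).
Proof.
move=> fx; have mlin : linear (fun z : R^o => z * r : R^o).
  by move=> s u v; rewrite mulrDl -[s *: (u * r)]/(s * (u * r)) mulrA.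
have [h hE] := mk_linear mlin.
have := pp_hom h pf fx; rewrite env_cons_comp hE.
have h0 (T : Type) : h \o (fun=> 0) = (fun=> 0) :> (T -> R^o).
  by apply/funext => i /=; rewrite linear0.
by rewrite 2!h0.
Qed.

Lemma ppR_span (a : seq R) : (forall x, x \in a -> ppR f x) -> rspan a `<=` ppR f.
Proof.
move=> af x /rspanP[y ->]; elim/big_ind: _ => [|u v fu fv|i _]; first exact: ppR0.
  by rewrite -[v]opprK -[- v]sub0r; apply: ppRB => //; apply: ppRB => //; exact: ppR0.
by apply/ppRMr/af/mem_nth.
Qed.

End Ideal.

(** * Generic solutions and elimination of quantifiers *)

Lemma infinite_uniq_seq (T : eqType) (A : set T) (m : nat) : infinite_set A ->
  exists s : seq T, [/\ uniq s, size s = m & forall x, x \in s -> A x].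
Proof.
move=> infA; elim: m => [|m [s [us sm sA]]]; first by exists [::].
have [x Ax xs] : exists2 x, A x & x \notin s.
  apply: contrapT => h; apply: infA; apply: (@sub_finite_set _ _ [set` s]).
    by move=> x Ax /=; apply: contrapT => /negP xs; apply: h; exists x.
  exact: finite_seq.
exists (x :: s); split=> /=; rewrite ?xs ?sm//.
by move=> y; rewrite inE => /orP[/eqP->//|/sA].
Qed.

Lemma pp_coset (R : pzRingType) (C I : Type) (c : C -> direct_sum R I) n
    (e : 'I_n -> direct_sum R I) (f g : mformula R C n.+1) b b' :
  pp f -> pp g -> ppR f `<=` ppR g ->
  satisfies c (env_cons b e) f -> satisfies c (env_cons b e) g ->
  satisfies c (env_cons b' e) f -> satisfies c (env_cons b' e) g.
Proof.
move=> pf pg fg fb gb /(pp_diff _ pf fb) h.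
apply/(pp_diff _ pg gb); move: h; rewrite -env_cons_sub.
rewrite (_ : (fun i => e i - e i) = fun=> 0); last first.
  by apply/funext => i; rewrite subrr.
have dE x i : (fun k => dcoord i (env_cons x (fun=> 0 : direct_sum R I) k)) =
    env_cons (dcoord i x) (fun=> 0) :> ('I_n.+1 -> R^o).
  rewrite -[LHS]/(dcoord i \o env_cons x (fun=> 0)) env_cons_comp.
  by congr env_cons; apply/funext => k /=; exact: linear0.
by rewrite !pp_dsum// => h i; rewrite dE; apply: fg; rewrite /ppR /= -dE.
Qed.

(** The parameters c are supposed to vanish on an infinite set I1 of coordinates,
    which supplies the fresh ones. *)
Section Generic.
Context (R : pzRingType) (syz : rsyz_fg R) (I : choiceType) (C : Type).
Local Notation F := (direct_sum R I).
Context (c : C -> F) (I1 : set I) (infI1 : infinite_set I1).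
Hypothesis cI1 : forall a i, I1 i -> dcoord i (c a) = 0.

Lemma zero_coords (s : seq I) : exists h : {linear F -> F}, forall x i,
  dcoord i (h x) = if i \in s then 0 else dcoord i x.
Proof.
pose h : {linear F -> F} := dlift (fun i => if i \in s then 0 else dbasis R i).
have hE j : h (dbasis R j) = if j \in s then 0 else dbasis R j.
  exact: dlift_basis.
exists h => x i; move: (h) hE => {}h hE.
have [t [ut xt _]] := dsupp_seq x x.
rewrite [x in LHS](dsum_expand ut xt) !linear_sum /=.
have e j : dcoord i (h ((dcoord j x : R) *: dbasis R j)) =
    if i \in s then 0 else dcoord i ((dcoord j x : R) *: dbasis R j).
  rewrite !linearZ /= hE; case: ifP => js; case: ifP => // is_.
  - by rewrite linear0 scaler0.
  - by rewrite linear0 -[RHS]/(_ * (j == i)%:R) (_ : (j == i) = false) ?mulr0 ?scaler0//;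
      apply: contraFF is_ => /eqP <-.
  - by rewrite -[LHS]/(_ * (j == i)%:R) (_ : (j == i) = false) ?mulr0//;
      apply: contraFF js => /eqP ->.
under eq_bigr do rewrite e; case: ifP => is_; first by rewrite big1.
by rewrite [x in RHS](dsum_expand ut xt) linear_sum.
Qed.

(** The coordinates of g - b at the fresh indices are generators of the right
    ideal ppR f. Zeroing those coordinates is an endomorphism that fixes the
    parameters and maps g to b, so a pp formula h true at g is true at b; then
    g - b satisfies h homogeneously, and reading the fresh coordinates one by
    one gives the inclusion. *)
Lemma generic_solution n (f : mformula R C n.+1) (e : 'I_n -> F) b : pp f ->
  satisfies c (env_cons b e) f ->
  exists g, satisfies c (env_cons g e) f /\
    forall h, pp h -> satisfies c (env_cons g e) h ->
      ppR f `<=` ppR h /\ satisfies c (env_cons b e) h.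
Proof.
move=> pf fb; have [a fa] := ppR_fg syz pf.
have [s [us sa sI1]] : exists s : seq I, [/\ uniq s, size s = size a &
    forall i, i \in s ->
      [/\ I1 i, dcoord i b = 0 & forall k, dcoord i (e k) = 0]].
  pose E : set I := [set i | dcoord i b != 0] `|`
    \bigcup_(k in [set: 'I_n]) [set i | dcoord i (e k) != 0].
  have finE : finite_set E.
    rewrite finite_setU; split; first exact: dcoord_fin.
    apply: bigcup_finite; first exact: finite_finset.
    by move=> k _; exact: dcoord_fin.
  have [|s [us sa sI1]] := @infinite_uniq_seq _ (I1 `\` E) (size a).
    by move=> fin; apply/infI1/(sub_finite_set _ (_ : finite_set (E `|` (I1 `\` E))));
      [move=> i Ii; have [|] := pselect (E i); [left|right]|rewrite finite_setU].
  exists s; split=> // i /sI1[Ii /not_orP[bi ei]]; split=> //.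
    by apply/eqP; apply: contrapT => /negP.
  move=> k; apply/eqP; apply: contrapT => /negP ek; apply: ei.
  by exists k.
pose d := \sum_(i <- s) a`_(index i s) *: dbasis R i.
have dE i : dcoord i d = if i \in s then a`_(index i s) else 0.
  rewrite /d linear_sum; case: ifP => is_.
    rewrite (big_rem i)//= big_seq big1 ?addr0.
      by rewrite -[LHS]/(_ * (i == i)%:R) eqxx mulr1.
    move=> j; rewrite mem_rem_uniq// inE => /andP[ji _].
    by rewrite -[LHS]/(_ * (j == i)%:R) (negbTE ji) mulr0.
  rewrite big_seq big1// => j js; rewrite -[LHS]/(_ * (j == i)%:R).
  by rewrite (_ : (j == i) = false) ?mulr0//; apply: contraFF is_ => /eqP <-.
have dcons x i : (fun k => dcoord i (env_cons x (fun=> 0 : F) k)) =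
    env_cons (dcoord i x) (fun=> 0) :> ('I_n.+1 -> R^o).
  rewrite -[LHS]/(dcoord i \o env_cons x (fun=> 0)) env_cons_comp.
  by congr env_cons; apply/funext => k /=; exact: linear0.
have bd_diff : (fun i => env_cons (b + d) e i - env_cons b e i) =
    env_cons d (fun=> 0) :> ('I_n.+1 -> F).
  rewrite -env_cons_sub addrC addKr; congr env_cons.
  by apply/funext => k; rewrite subrr.
exists (b + d); split.
  apply/(pp_diff _ pf fb); rewrite bd_diff pp_dsum// => i; rewrite dcons dE.
  change (ppR f (if i \in s then a`_(index i s) else 0)).
  rewrite fa; case: ifP => is_; last exact: rspan0.
  by apply: rspan_nth; rewrite -sa index_mem.
move=> h ph hg; have [p pE] := zero_coords s.
have hb : satisfies c (env_cons b e) h.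
  have := pp_hom p ph hg; rewrite env_cons_comp.
  have pfix x : (forall i, i \in s -> dcoord i x = 0) -> p x = x.
    by move=> x0; apply: dsum_ext => i; rewrite pE; case: ifP => // /x0.
  have -> : p \o c = c.
    by apply/funext => k /=; apply: pfix => i /sI1[Ii _ _]; exact: cI1.
  have -> : p \o e = e.
    by apply/funext => k /=; apply: pfix => i /sI1[_ _].
  have -> // : p (b + d) = b.
  rewrite linearD pfix => [|i /sI1[]//].
  rewrite (_ : p d = 0) ?addr0//; apply: dsum_ext => i.
  by rewrite pE dE linear0; case: (i \in s).
split=> //; rewrite fa; apply: ppR_span => // x /(nthP 0)[k ka <-].
have := (pp_diff _ ph hb).1 hg; rewrite bd_diff pp_dsum// => hd.
have [i0 _] : exists i0 : I, i0 \in s.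
  by case: (s) sa => [sa|i0 s' _]; [rewrite -sa in ka|exists i0; rewrite inE eqxx].
have ks : (k < size s)%N by rewrite sa.
have := hd (nth i0 s k); rewrite dcons dE mem_nth// index_uniq//.
Qed.

Definition agree n (T : finType) (Phi : T -> mformula R C n) (e e' : 'I_n -> F) :=
  forall t, satisfies c e (Phi t) <-> satisfies c e' (Phi t).

Definition big_and n (T : finType) (Phi : T -> mformula R C n) (S : {set T}) :=
  foldr (fun t f => FAnd (Phi t) f) (FEq (TZero _ _ _) (TZero _ _ _)) (enum S).

Lemma pp_big_and n (T : finType) (Phi : T -> mformula R C n) (S : {set T}) :
  (forall t, pp (Phi t)) -> pp (big_and Phi S).
Proof. by move=> pPhi; rewrite /big_and; elim: (enum S) => //= t s ->. Qed.

Lemma big_andP n (T : finType) (Phi : T -> mformula R C n) (S : {set T}) e :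
  satisfies c e (big_and Phi S) <-> forall t, t \in S -> satisfies c e (Phi t).
Proof.
suff and_seq s : satisfies c e (foldr (fun t f => FAnd (Phi t) f)
    (FEq (TZero _ _ _) (TZero _ _ _)) s) <->
    forall t, t \in s -> satisfies c e (Phi t).
  by rewrite and_seq; split=> h t; have := h t; rewrite mem_enum.
elim: s => [|t s IH] /=; first by split.
rewrite IH; split=> [[ht hs] u|h]; first by rewrite inE => /orP[/eqP->|/hs].
by split=> [|u us]; apply: h; rewrite inE ?eqxx ?us ?orbT.
Qed.

(** Elimination of quantifiers, in the form that the truth of a formula depends
    on the truth of finitely many pp formulas. For an existential formula with
    body determined by Phi, take the existential closures of all conjunctions of
    members of Phi. If e and e' agree on these and x is a witness for e, a
    generic solution over e' of the conjunction of the members of Phi true at x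
    satisfies no further member of Phi: a further member would be implied by the
    conjunction, over e' and hence over e. *)
Lemma pp_determined n (f : mformula R C n) :
  exists (T : finType) (Phi : T -> mformula R C n), (forall t, pp (Phi t)) /\
    forall e e', agree Phi e e' -> satisfies c e f <-> satisfies c e' f.
Proof.
elim: f => [{}n t u|{}n f [T [Phi [pPhi fPhi]]]|
  {}n f [T [Phi [pPhi fPhi]]] g [U [Psi [pPsi gPsi]]]|
  {}n f [T [Phi [pPhi fPhi]]]].
- by exists unit, (fun=> FEq t u); split=> // e e' /(_ tt).
- by exists T, Phi; split=> // e e' /fPhi h; rewrite /= h.
- exists (T + U)%type, (fun x => match x with inl t => Phi t | inr u => Psi u end).
  split=> [[]//|e e' h] /=; rewrite (fPhi e e') ?(gPsi e e')//.
    by move=> u; exact: (h (inr u)).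
  by move=> t; exact: (h (inl t)).
exists {set T}, (fun S => FEx (big_and Phi S)).
split=> [S /=|]; first exact: pp_big_and.
suff half e e' : agree (fun S : {set T} => FEx (big_and Phi S)) e e' ->
    satisfies c e (FEx f) -> satisfies c e' (FEx f).
  by move=> e e' ee'; split; apply: half => // S; split=> /(ee' S).
move=> ee' /= [x fx]; pose S := [set t | `[< satisfies c (env_cons x e) (Phi t) >]]%SET.
have pS : pp (big_and Phi S) by exact: pp_big_and.
have xS : satisfies c (env_cons x e) (big_and Phi S).
  by apply/big_andP => t; rewrite inE => /asboolP.
have [b bS] : satisfies c e' (FEx (big_and Phi S)) by apply/ee'; exists x.
have [g [gS gP]] := generic_solution pS bS.
exists g; suff ag : agree Phi (env_cons x e) (env_cons g e') by exact: (fPhi _ _ ag).1.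
move=> t; split=> [xt|gt].
  by have /big_andP := gS; apply; rewrite inE; apply/asboolP.
have [St bt] := gP _ (pPhi t) gt.
have [b1 /big_andP b1S] : satisfies c e (FEx (big_and Phi (t |: S)%SET)).
  apply/ee'; exists b; apply/big_andP => u; rewrite !inE => /orP[/eqP->//|uS].
  by have /big_andP := bS; apply; rewrite inE.
apply: (pp_coset pS (pPhi t) St _ _ xS); last by apply: b1S; rewrite !inE eqxx.
by apply/big_andP => u uS; apply: b1S; rewrite inE uS orbT.
Qed.

End Generic.

(** * Realizing types *)

Lemma type_ultrafilter (R : pzRingType) (M : lmodType R) (A : set M)
    (p : set (mformula R A 1)) : is_1type p ->
  exists U : set_system M, UltraFilter U /\
    forall f, p f -> U [set x | satisfies set_val (fun=> x) f].
Proof.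
move=> ptype.
pose F : set_system M := [set X | exists q : set (mformula R A 1),
  [/\ finite_set q, q `<=` p & forall x, realizes x q -> X x]].
have FF : Filter F.
  split=> [|X Y [q [fq qp qX]] [r [fr rp rY]]|X Y XY [q [fq qp qX]]].
  - by exists set0; split=> //; exact: finite_set0.
  - exists (q `|` r); split; first by rewrite finite_setU.
      by move=> f [/qp|/rp].
    by move=> x xqr; split; [apply: qX|apply: rY] => f ?; apply: xqr; [left|right].
  by exists q; split=> // x /qX/XY.
have PF : ProperFilter F.
  apply: Build_ProperFilter_ex => X [q [fq qp qX]].
  by have [x /qX] := ptype q fq qp; exists x.
have [U [ultraU FU]] := @ultraFilterLemma _ F PF.
exists U; split=> // f pf; apply: FU; exists [set f]; split.
- exact: finite_set1.
- by move=> _ ->.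
by move=> x; apply.
Qed.

Section Saturation.
Context (R : pzRingType) (syz : rsyz_fg R) (dcc : fgr_dcc R) (I : choiceType).
Local Notation F := (direct_sum R I).

(** Take f0 in the ultrafilter with ppR f0 least. A pp formula is in the
    ultrafilter exactly if it is implied by f0, that is, exactly if it holds at
    a generic solution g of f0. By elimination of quantifiers each formula of
    the type then holds at g, as it holds at some point agreeing with g on
    finitely many pp formulas. *)
Lemma realize_type (A : set F) (I1 : set I) (p : set (mformula R A 1)) :
  infinite_set I1 -> (forall x i, A x -> I1 i -> dcoord i x = 0) ->
  is_1type p -> exists x, realizes x p.
Proof.
move=> infI1 AI1 /type_ultrafilter[U [ultraU pU]].
pose c : A -> F := set_val.
have cI1 a i : I1 i -> dcoord i (c a) = 0 by apply: AI1; exact: set_valP.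
pose e0 : 'I_0 -> F := fun=> 0.
have env1 x : (fun=> x) = env_cons x e0 :> ('I_1 -> F).
  by apply/funext => i; rewrite ord1 /env_cons unlift_none.
pose S (f : mformula R A 1) := [set x | satisfies c (env_cons x e0) f].
have Uex X : U X -> exists x, X x by exact: filter_ex.
have /choice[s sP] : forall f : mformula R A 1, exists s, pp f -> ppR f = rspan s.
  move=> f; have [pf|npf] := pselect (pp f); last by exists [::].
  by have [s fs] := ppR_fg syz pf; exists s.
have [|f0 [[pf0 Uf0] f0min]] := fgr_min
    (Q := fun f : mformula R A 1 => pp f /\ U (S f)) s dcc.
  exists (FEq (TZero _ _ _) (TZero _ _ _)); split=> //.
  by apply: filterS filterT => x _.
have f0le f : pp f -> U (S f) -> ppR f0 `<=` ppR f.
  move=> pf Uf; have pff : pp (FAnd f0 f) by [].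
  have /f0min : pp (FAnd f0 f) /\ U (S (FAnd f0 f)).
    by split=> //; apply: filterS (filterI Uf0 Uf) => x [].
  rewrite -!sP// => h; have le : ppR (FAnd f0 f) `<=` ppR f0 by move=> y [].
  by move=> x /(h le)[].
have [b f0b] := Uex _ Uf0.
have [g [f0g gP]] := generic_solution syz infI1 cI1 pf0 f0b.
have ppU f : pp f -> S f g <-> U (S f).
  move=> pf; split=> [fg|Uf].
    have [f0f fb] := gP _ pf fg; apply: filterS Uf0 => x f0x.
    exact: (pp_coset pf0 pf f0f f0b fb f0x).
  have [b1 [f0b1 fb1]] := Uex _ (filterI Uf0 Uf).
  exact: (pp_coset pf0 pf (f0le _ pf Uf) f0b1 fb1 f0g).
exists g => f pf; rewrite env1.
have [T [Phi [pPhi fPhi]]] := pp_determined syz infI1 cI1 f.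
have : U [set x | forall t, S (Phi t) x <-> S (Phi t) g].
  apply: (@filter_forall _ T (fun t x => S (Phi t) x <-> S (Phi t) g)) => t.
  have [gt|ngt] := pselect (S (Phi t) g).
    by have /(ppU _ (pPhi t)) := gt; apply: filterS => x.
  have [Ut|] := in_ultra_setVsetC (S (Phi t)) ultraU.
    by case: ngt; apply/(ppU _ (pPhi t)).
  by apply: filterS => x /= nx; split.
move=> /(filterI (pU _ pf))/Uex[x [fx xg]].
by apply: (fPhi _ _ xg).1; rewrite -env1.
Qed.

End Saturation.

(** * Cardinalities *)

Lemma card_le_inj (T U : Type) (A : set T) (B : set U) (f : T -> U) :
  (forall x, A x -> B (f x)) ->
  (forall x y, A x -> A y -> f x = f y -> x = y) -> A #<= B.
Proof.
move=> fAB finj; have /card_eqPle[_ h] : f @` A #= A.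
  by apply: inj_card_eq => x y /set_mem Ax /set_mem Ay; exact: finj.
apply: card_le_trans h _; apply: subset_card_le.
by move=> _ [x Ax <-]; exact: fAB.
Qed.

Lemma card_le_ex_inj (T U : Type) (A : set T) (B : set U) (u0 : U) : A #<= B ->
  exists f : T -> U, (forall x, A x -> B (f x)) /\
    forall x y, A x -> A y -> f x = f y -> x = y.
Proof.
move=> /card_leP[f]; exists (fun x => oapp (fun y => \val (f y)) u0 (insub x)).
have fE x (Ax : A x) : insub x = Some (SigSub (mem_set Ax)) :> option A.
  exact: insubT.
split=> [x Ax|x y Ax Ay].
  by rewrite fE /=; exact: set_valP.
rewrite !fE => e.
have finj : {in [set: A] &, injective f} by exact: inj.
have fe : f (SigSub (mem_set Ax)) = f (SigSub (mem_set Ay)) by exact: val_inj.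
by have /(congr1 val) := finj _ _ (in_setT _) (in_setT _) fe.
Qed.

Lemma infinite_nat_inj (T : Type) (A : set T) : infinite_set A ->
  exists f : nat -> T, (forall n, A (f n)) /\ injective f.
Proof.
move=> infA; have [x0 _] : exists x, A x.
  by apply: contrapT => h; apply: infA; rewrite (_ : A = set0)//;
    apply/seteqP; split=> // x Ax; case: h; exists x.
have /infiniteP/(@card_le_ex_inj _ _ _ _ x0)[f [fA finj]] := infA.
by exists f; split=> [n|m n]; [exact: fA|exact: finj].
Qed.

Section TimesNat.
Context (T : Type) (A : set T).

(* The graphs of injections of D * nat into D, for D a subset of A; the set D
   is read off the graph. *)
Let dom (G : set (T * nat * T)) : set T := [set x | exists n y, G (x, n, y)].
Let good (G : set (T * nat * T)) : Prop :=
  [/\ forall x n y, G (x, n, y) -> A x /\ dom G y,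
      forall x n, dom G x -> exists y, G (x, n, y),
      forall x n y y', G (x, n, y) -> G (x, n, y') -> y = y' &
      forall x n x' n' y, G (x, n, y) -> G (x', n', y) -> x = x' /\ n = n'].

Lemma times_nat_max : exists G, good G /\ forall H, G `<` H -> ~ good H.
Proof.
apply: Zorn_bigcup => F Fgood Ftot.
have two s t : (\bigcup_(X in F) X) s -> (\bigcup_(X in F) X) t ->
    exists X, [/\ F X, X s & X t].
  move=> [X FX Xs] [Y FY Yt]; have [XY|YX] := Ftot _ _ FX FY.
    by exists Y; split=> //; exact: XY.
  by exists X; split=> //; exact: YX.
split.
- move=> x n y [X FX Xx]; have [XA _ _ _] := Fgood _ FX.
  have [Ax [m [z Xy]]] := XA _ _ _ Xx; split=> //.
  by exists m, z, X.
- move=> x n [m [z [X FX Xx]]]; have [_ tot _ _] := Fgood _ FX.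
  have [|y Xy] := tot x n; first by exists m, z.
  by exists y, X.
- move=> x n y y' Gy Gy'; have [X [FX Xy Xy']] := two _ _ Gy Gy'.
  by have [_ _ + _] := Fgood _ FX; apply; eauto.
move=> x n x' n' y Gx Gx'; have [X [FX Xx Xx']] := two _ _ Gx Gx'.
by have [_ _ _] := Fgood _ FX; apply; eauto.
Qed.

(** For a maximal graph the complement of D in A is finite, since an infinite
    one contains a copy of nat, on which nat * nat injects into nat. The finitely
    many remaining elements are absorbed by iterating the injection j of D * nat
    into D: the second argument, 0 or 1, of the outer j keeps them apart from
    the elements of D. *)
Lemma infinite_times_nat : infinite_set A -> A `*` [set: nat] #<= A.
Proof.
move=> infA; have [G [[GA Gtot Gfun Ginj] Gmax]] := times_nat_max.
pose D := dom G; have DA x : D x -> A x by move=> [n [y /GA[]]].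
have finAD : finite_set (A `\` D).
  apply: contrapT => infAD; have [f [fAD finj]] := infinite_nat_inj infAD.
  pose H := G `|` [set t : T * nat * T | exists k,
    t = (f k, t.1.2, f (pickle (k, t.1.2)))].
  have HG x n y : D x -> H (x, n, y) -> G (x, n, y).
    move=> Dx [//|[k /= [xk _]]]; have [_] := fAD k; by rewrite -xk.
  have domf k : dom H (f k).
    by exists 0%N, (f (pickle (k, 0%N))); right; exists k.
  have domD x : D x -> dom H x.
    by move=> [n [y Gx]]; exists n, y; left.
  apply: (Gmax H).
    split=> [t Gt|HsubG]; first by left.
    have [_] := fAD 0%N; apply; exists 0%N, (f (pickle (0%N, 0%N))).
    by apply: HsubG; right; exists 0%N.
  split.
  - move=> x n y [/GA[Ax Dy]|[k /= [-> ->]]]; first by split=> //; exact: domD.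
    by split=> //; have [] := fAD k.
  - move=> x n [m [y [Gx|[k /= [-> _]]]]].
      have [|z Gz] := Gtot x n; first by exists m, y.
      by exists z; left.
    by exists (f (pickle (k, n))); right; exists k.
  - move=> x n y y' [Gy|[k /= [xk yk]]] Hy'.
      by apply: (Gfun x n) => //; apply: HG => //; exists n, y.
    case: Hy' => [Gy'|[k' /= [xk' yk']]].
      by have [_] := fAD k; case; rewrite -xk; exists n, y'.
    by move: xk'; rewrite xk yk yk' => /finj ->.
  move=> x n x' n' y [Gx|[k /= [xk yk]]] [Gx'|[k' /= [xk' yk']]].
  - exact: Ginj Gx Gx'.
  - by have [_] := fAD (pickle (k', n')); case; rewrite -yk'; have [] := GA _ _ _ Gx.
  - by have [_] := fAD (pickle (k, n)); case; rewrite -yk; have [] := GA _ _ _ Gx'.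
  have := yk'; rewrite yk => /finj/(pcan_inj pickleK)[kk nn].
  by rewrite xk xk' kk nn.
have [d0 Dd0] : exists d, D d.
  apply: contrapT => nD; apply: infA; rewrite (_ : A = A `\` D)//.
  by apply/seteqP; split=> [x Ax|x []//]; split=> // Dx; apply: nD; exists x.
have /choice[j jP] : forall t : T * nat, exists y, D t.1 -> G (t, y).
  move=> [x n]; have [Dx|nDx] := pselect (D x); last by exists d0.
  by have [y Gy] := Gtot x n Dx; exists y.
have jD t : D t.1 -> D (j t) by move: t => [x n] /jP/GA[].
have jinj t t' : D t.1 -> D t'.1 -> j t = j t' -> t = t'.
  move: t t' => [x n] [x' n'] /jP Gx /jP Gx' e; move: Gx; rewrite e => Gx.
  by have [-> ->] := Ginj _ _ _ _ _ Gx Gx'.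
have [r rinj] : exists r : T -> nat, forall x y,
    (A `\` D) x -> (A `\` D) y -> r x = r y -> x = y.
  have /finite_set_countable/(@card_le_ex_inj _ _ _ _ 0%N)[r [_ rinj]] := finAD.
  by exists r.
apply: (@card_le_inj _ _ _ _ (fun t => if pselect (D t.1) then j (j t, 0%N)
   else j (j (d0, pickle (r t.1, t.2)), 1%N))).
  move=> t [At _]; apply: DA; case: pselect => Dt; apply: (jD) => /=; exact: (jD).
move=> t t' [/= At _] [/= At' _].
have jjinj u v k l : D u.1 -> D v.1 -> j (j u, k) = j (j v, l) -> u = v /\ k = l.
  move=> Du Dv e.
  have [juv ->] := jinj (j u, k) (j v, l) (jD _ Du) (jD _ Dv) e.
  by split=> //; exact: (jinj _ _ Du Dv).
case: pselect => Dt; case: pselect => Dt' e.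
- by have [] := jjinj t t' _ _ Dt Dt' e.
- by have [] := jjinj t (d0, _) _ _ Dt Dd0 e.
- by have [] := jjinj (d0, _) t' _ _ Dd0 Dt' e.
have [[/(pcan_inj pickleK)[rr tt]] _] := jjinj (d0, _) (d0, _) _ _ Dd0 Dd0 e.
by rewrite (surjective_pairing t) (surjective_pairing t') tt (rinj _ _ _ _ rr).
Qed.

End TimesNat.

(** An index is determined by its image and by its rank in a finite fibre. *)
Lemma finite_to_one_card (I T : Type) (h : I -> T) (A : set T) :
  infinite_set [set: I] -> (forall i, A (h i)) ->
  (forall a, finite_set [set i | h i = a]) -> [set: I] #<= A.
Proof.
move=> infI hA hfin.
have infA : infinite_set A.
  move=> finA; apply: infI.
  rewrite (_ : [set: I] = \bigcup_(a in A) [set i | h i = a]).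
    by apply: bigcup_finite.
  by apply/seteqP; split=> // i _; exists (h i).
have /choice[r rinj] : forall a, exists r : I -> nat, forall i j,
    h i = a -> h j = a -> r i = r j -> i = j.
  move=> a; have /finite_set_countable/(@card_le_ex_inj _ _ _ _ 0%N)[r [_ rinj]] := hfin a.
  by exists r.
apply: card_le_trans (infinite_times_nat infA).
apply: (@card_le_inj _ _ _ _ (fun i => (h i, r (h i) i))) => [i _|i j _ _ [hij]].
  by split=> /=.
by rewrite -hij; exact: rinj.
Qed.

(** * Consequences of saturation *)

Section SpanFormula.
Context (R : pzRingType) (C : Type).

Fixpoint tshift n (t : mterm R C n) : mterm R C n.+1 :=
  match t with
  | TVar i => TVar _ _ (lift ord0 i)
  | TConst a => TConst _ _ a
  | TZero => TZero _ _ _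
  | TOpp u => TOpp (tshift u)
  | TAdd u v => TAdd (tshift u) (tshift v)
  | TScale r u => TScale r (tshift u)
  end.

Lemma teval_shift (M : lmodType R) (c : C -> M) n x (e : 'I_n -> M) t :
  teval c (env_cons x e) (tshift t) = teval c e t.
Proof.
elim: t => //= [i|t ->|t -> u ->|r t ->] //.
by rewrite /env_cons liftK.
Qed.

(** Each quantifier binds the multiplier of one entry of s, in the order in which
    [lincomb] consumes them. *)
Fixpoint span_fml (s : seq R) n (t : mterm R C n) : mformula R C n :=
  if s is r :: s' then
    FEx (span_fml s' (TAdd (tshift t) (TOpp (TScale r (TVar _ _ ord0)))))
  else FEq t (TZero _ _ _).

Lemma span_fmlP (M : lmodType R) (c : C -> M) s n (e : 'I_n -> M) t :
  satisfies c e (span_fml s t) <-> lincomb s (teval c e t).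
Proof.
elim: s n e t => [//|r s IH] n e t /=.
by split=> -[x h]; exists x; move: h; rewrite IH /= teval_shift /env_cons unlift_none.
Qed.

Lemma pp_span_fml s n (t : mterm R C n) : pp (span_fml s t).
Proof. by elim: s n t => //= r s IH n t. Qed.

End SpanFormula.

Lemma lincomb_dsum (R : pzRingType) (I : Type) (s : seq R) (z : direct_sum R I) :
  lincomb s z <-> forall i, rspan s (dcoord i z).
Proof.
pose t : mterm R False 1 := TVar _ _ ord0.
have spanE (M : lmodType R) (x : M) : holds0 (fun=> x) (span_fml s t) <-> lincomb s x.
  exact: span_fmlP.
rewrite -spanE (pp_dsum _ (pp_span_fml s t)).
by split=> zs i; apply/spanE; exact: zs.
Qed.

Section Saturated.
Context (R : pzRingType) (I : choiceType).
Local Notation F := (direct_sum R I).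
Hypothesis infR : infinite_set [set: R].
Hypothesis ltRI : card_lt [set: R] [set: I].
Hypothesis sat : saturated I F.

Lemma countable_card_lt (T : Type) (A : set T) : countable A -> card_lt A [set: I].
Proof.
have [RI nIR] := ltRI => cA; have AR : (A #<= [set: R])%card.
  by apply: card_le_trans cA _; exact/infiniteP.
split; first exact: card_le_trans RI.
by move=> IA; apply: nIR; exact: card_le_trans IA AR.
Qed.

Lemma infI : infinite_set [set: I].
Proof.
move=> finI; apply: infR; have [RI _] := ltRI.
exact: card_le_finite RI finI.
Qed.

Lemma finite_bound (T : Type) (q : set T) (P : T -> nat -> Prop) : finite_set q ->
  (forall f, q f -> exists n, P f n) ->
  (forall f n m, (n <= m)%N -> P f n -> P f m) ->
  exists N, forall f, q f -> P f N.
Proof.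
move=> finq qP Pmono; have /finite_seqP[s qs] : finite_set (q : set {classic T}) by [].
have sP f : f \in s -> exists n, P f n.
  by move=> fs; apply: qP; rewrite qs.
have [N NP] : exists N, forall f, f \in s -> P f N; last first.
  by exists N => f; rewrite qs => /NP.
elim: s sP {qs} => [|f s IH] sP; first by exists 0%N.
have [|N NP] := IH; first by move=> g gs; apply: sP; rewrite inE gs orbT.
have [|n fn] := sP f; first by rewrite inE eqxx.
exists (maxn n N) => g; rewrite inE => /orP[/eqP->|/NP].
  exact: Pmono (leq_maxl _ _) fn.
exact/Pmono/leq_maxr.
Qed.

(** For a strictly decreasing chain b with r k in the k-th ideal but not in the
    next one, the sum over k of r k in the coordinate iota k is approximated by
    its partial sums d n. An element congruent to d n modulo the n-th ideal, for
    every n, has a nonzero coordinate at each iota k. *)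
Lemma saturated_dcc : fgr_dcc R.
Proof.
apply: contrapT => /fgr_strict_chain[b [r [bmono brP]]].
have rb k : rspan (b k) (r k) by have [] := brP k.
have nrb k : ~ rspan (b k.+1) (r k) by have [] := brP k.
have [iota [_ iinj]] := infinite_nat_inj infI.
pose d n := \sum_(k < n) r k *: dbasis R (iota k) : F.
have dS n k i : rspan (b n) (dcoord i (d (n + k)%N - d n)).
  elim: k => [|k IH]; first by rewrite addn0 subrr linear0; exact: rspan0.
  rewrite addnS {1}/d big_ord_recr /= -/(d _) addrAC linearD; apply: rspanD => //.
  by apply: rspanMr; apply: (bmono n (n + k)%N); [exact: leq_addr|exact: rb].
have dn n : dcoord (iota n) (d n.+1) = r n.
  rewrite /d linear_sum (bigD1 ord_max)//= big1 => [|k kn].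
    by rewrite addr0 -[LHS]/(_ * (_ == _)%:R) eqxx mulr1.
  rewrite -[LHS]/(_ * (_ == _)%:R) (_ : (_ == _) = false) ?mulr0//.
  by apply: contraNF kn => /eqP/iinj kn; apply/eqP/val_inj.
pose A : set F := range d.
pose cd n : A := SigSub (mem_set (imageT d n)).
pose fml n : mformula R A 1 :=
  span_fml (b n) (TAdd (TVar _ _ ord0) (TOpp (TConst _ _ (cd n)))).
have fmlP n x : satisfies set_val (fun=> x) (fml n) <->
    forall i, rspan (b n) (dcoord i (x - d n)).
  by rewrite span_fmlP lincomb_dsum.
have cA : card_lt A [set: I].
  by apply: countable_card_lt; apply: card_le_trans (card_image_le _ _) _.
have [|x xP] := sat cA (p := range fml).
  move=> q finq qfml; have [| |N NP] := @finite_bound _ q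
    (fun f N => exists2 n, (n <= N)%N & f = fml n) finq.
  - by move=> f /qfml[n _ <-]; exists n, n.
  - by move=> f n m nm [k kn ->]; exists k => //; exact: leq_trans nm.
  exists (d N) => f /NP[n nN ->]; apply/fmlP => i.
  by rewrite -(subnKC nN).
have supp n : dcoord (iota n) x != 0.
  apply/eqP => x0; apply: (nrb n).
  have /fmlP/(_ (iota n)) : satisfies set_val (fun=> x) (fml n.+1).
    by apply: xP; exists n.+1.
  rewrite linearB /= x0 dn sub0r => h.
  by rewrite -[r n]opprK -[- - r n]mulrN1; exact: rspanMr.
have /infiniteP : ([set: nat] #<= [set i | dcoord i x != 0])%card.
  by apply: (@card_le_inj _ _ _ _ iota) => [n _|m n _ _ /iinj//]; exact: supp.
by apply; exact: dcoord_fin.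
Qed.

(** The type says that x satisfies f and lies in no right ideal generated by
    finitely many elements of ppR f. In F no such x exists, because its nonzero
    coordinates are such a finite set. *)
Lemma saturated_ppR_fg (f : mformula R (set0 : set F) 1) : pp f ->
  exists a, ppR f = rspan a.
Proof.
move=> pf; apply: contrapT => nfg.
have [i0 _] : exists i : I, True.
  by apply: contrapT => nI; apply: infI; rewrite (_ : [set: I] = set0)//;
    apply/seteqP; split=> // i; case: nI; exists i.
pose neg a : mformula R (set0 : set F) 1 := FNot (span_fml a (TVar _ _ ord0)).
pose p : set (mformula R (set0 : set F) 1) := [set f] `|`
  [set neg a | a in [set a | forall x, x \in a -> ppR f x]].
have env1 (M : lmodType R) (x : M) :
    (fun=> x) = env_cons x (fun=> 0) :> ('I_1 -> M).
  by apply/funext => i; rewrite ord1 /env_cons unlift_none.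
have noC : set_val = (fun=> 0) :> (set_type (set0 : set F) -> F).
  by apply/funext => -[a a0]; have := set_mem a0.
have fP x : satisfies set_val (fun=> x) f <-> forall i, ppR f (dcoord i x).
  rewrite noC -[satisfies _ _ _]/(holds0 _ _) pp_dsum//.
  by split=> h i; have := h i; rewrite /ppR /= env1.
have negP a x : satisfies set_val (fun=> x) (neg a) <->
    ~ forall i, rspan a (dcoord i x).
  by rewrite /= span_fmlP lincomb_dsum.
have c0 : card_lt (set0 : set F) [set: I].
  exact/countable_card_lt/countable0.
have [|x xP] := sat c0 (p := p).
  move=> q finq qp.
  have [a [af qa]] : exists a : seq R, (forall x, x \in a -> ppR f x) /\
      forall g, q g -> g = f \/ exists2 a', g = neg a' & {subset a' <= a}.
    have /finite_seqP[s qs] :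
      finite_set (q : set {classic mformula R (set0 : set F) 1}) by [].
    have sp g : g \in s -> p g by move=> gs; apply: qp; rewrite qs.
    have [a [af sa]] : exists a : seq R, (forall x, x \in a -> ppR f x) /\
        forall g, g \in s -> g = f \/ exists2 a', g = neg a' & {subset a' <= a}.
      elim: s sp {qs} => [|g s IH] sp; first by exists [::].
      have [|a [af sa]] := IH; first by move=> h hs; apply: sp; rewrite inE hs orbT.
      have [->|[a' a'f <-]] := sp g (mem_head _ _).
        exists a; split=> // h; rewrite inE => /orP[/eqP->|/sa//]; by left.
      exists (a' ++ a); split=> [x|h].
        by rewrite mem_cat => /orP[/a'f|/af].
      rewrite inE => /orP[/eqP->|/sa[->|[a2 -> a2a]]]; [right|by left|right].
        by exists a' => // x; rewrite mem_cat => ->.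
      by exists a2 => // x /a2a; rewrite mem_cat orbC => ->.
    by exists a; split=> // g; rewrite qs => /sa.
  have [x fx ax] : exists2 x, ppR f x & ~ rspan a x.
    apply: contrapT => h; apply: nfg; exists a; apply/seteqP; split.
      by move=> x fx; apply: contrapT => ax; apply: h; exists x.
    exact: ppR_span.
  exists (x *: dbasis R i0) => g /qa[->|[a' -> aa']].
    apply/fP => i; rewrite -[dcoord _ _]/(x * (i0 == i)%:R).
    by apply: ppRMr.
  apply/negP => /(_ i0); rewrite -[dcoord _ _]/(x * (i0 == i0)%:R) eqxx mulr1.
  move=> a'x; apply: ax; apply: rspan_le a'x => y /aa' ya.
  by rewrite -(nth_index 0 ya); apply: rspan_nth; rewrite index_mem.
have /fP fx : satisfies set_val (fun=> x) f by apply: xP; left.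
have [s [us xs _]] := dsupp_seq x x.
pose a : seq R := [seq dcoord i x | i <- s].
have /negP : satisfies set_val (fun=> x) (neg a).
  by apply: xP; right; exists a => // y /mapP[i _ ->].
apply=> i; have [->|/xs is_] := eqVneq (dcoord i x : R) 0; first exact: rspan0.
have ia : (dcoord i x : R) \in a by apply: map_f.
by rewrite -(nth_index 0 ia); apply: rspan_nth; rewrite index_mem.
Qed.

(** Induction on the number of unknowns. The first coordinates of syzygies form a
    pp subgroup of R, hence a finitely generated right ideal; lifts of its
    generators, together with the syzygies of first coordinate 0, generate. *)
Lemma saturated_rsyz : rsyz_fg R.
Proof.
elim=> [|n IH] a.
  exists 0%N, (fun _ _ => 0) => u; split=> _; last by rewrite /= big_ord0.
  by exists (fun=> 0) => -[].
have [m [k kP]] := IH (fun i => a (lift ord0 i)).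
pose s := [seq a (lift ord0 i) | i <- enum 'I_n].
pose f : mformula R (set0 : set F) 1 := span_fml s (TScale (a ord0) (TVar _ _ ord0)).
have [b fb] := saturated_ppR_fg (pp_span_fml _ _ : pp f).
have fE x : rspan b x <-> exists y : 'I_n -> R,
    a ord0 * x = \sum_i a (lift ord0 i) * y i.
  rewrite -fb; apply: iff_trans (span_fmlP _ _ _ _) _.
  by rewrite /= /env_cons unlift_none; exact: lincomb_ord.
have /choice[w wP] : forall j : 'I_(size b), exists y : 'I_n -> R,
    a ord0 * b`_j = \sum_i a (lift ord0 i) * y i.
  by move=> j; apply/fE; exact: rspan_nth.
pose g (j : 'I_(size b + m)) : 'I_n.+1 -> R := match fintype.split j with
  | inl j' => env_cons b`_j' (fun i => - w j' i)
  | inr j' => env_cons 0 (k j') end.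
have gl j : g (lshift m j) = env_cons b`_j (fun i => - w j i).
  by rewrite /g (unsplitK (inl j)).
have gr j : g (rshift (size b) j) = env_cons 0 (k j).
  by rewrite /g (unsplitK (inr j)).
have syz_cons x (y : 'I_n -> R) : \sum_i a i * env_cons x y i =
    a ord0 * x + \sum_i a (lift ord0 i) * y i.
  rewrite big_ord_recl /env_cons unlift_none; congr (_ + _).
  by apply: eq_bigr => i _; rewrite liftK.
have gsyz j : \sum_i a i * g j i = 0.
  case: (split_ordP j) => j' ->; rewrite ?gl ?gr syz_cons.
    by rewrite wP -big_split big1// => i _ /=; rewrite mulrN subrr.
  rewrite mulr0 add0r; apply/kP; exists (fun j => (j == j')%:R) => i.
  rewrite (bigD1 j')//= eqxx mulr1 big1 ?addr0// => j0 /negbTE ->.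
  by rewrite mulr0.
exists (size b + m)%N, g => u; split=> [/= usyz|[r ur]] /=; last first.
  under eq_bigr do rewrite ur mulr_sumr.
  rewrite exchange_big big1// => j _.
  by under eq_bigr do rewrite mulrA; rewrite -mulr_suml gsyz mul0r.
rewrite big_ord_recl in usyz.
have /rspanP[r ur] : rspan b (u ord0).
  apply/fE; exists (fun i => - u (lift ord0 i)).
  apply/eqP; rewrite -subr_eq0 -sumrN; apply/eqP; rewrite -[RHS]usyz.
  by congr (_ + _); apply: eq_bigr => i _; rewrite mulrN opprK.
have [t tP] : exists t, forall i, u (lift ord0 i) + \sum_j w j i * r j =
    \sum_q k q i * t q.
  apply/(kP (fun i => _ + _)) => /=.
  under eq_bigr do rewrite mulrDr mulr_sumr.
  rewrite big_split /= exchange_big /= -[RHS]usyz addrC; congr (_ + _).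
  rewrite ur mulr_sumr; apply: eq_bigr => j _.
  by rewrite mulrA wP mulr_suml; apply: eq_bigr => i _; rewrite mulrA.
exists (fun j => match fintype.split j with inl j' => r j' | inr q => t q end) => i.
rewrite big_split_ord /=.
under eq_bigr do rewrite gl (unsplitK (inl _)).
under [X in _ + X]eq_bigr do rewrite gr (unsplitK (inr _)).
case: (unliftP ord0 i) => [i' ->|->]; rewrite /env_cons ?liftK ?unlift_none /=.
  rewrite -tP addrCA -big_split big1 ?addr0// => j _ /=.
  by rewrite mulNr addNr.
by rewrite -ur big1 ?addr0// => q _; rewrite mul0r.
Qed.

End Saturated.

(** * Finite rings *)

Section FiniteRing.
Context (R : pzRingType) (finR : finite_set [set: R]).

Lemma finite_dcc : fgr_dcc R.
Proof.
apply: contrapT => /fgr_strict_chain[b [r [bmono brP]]].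
have rlt m n : (m < n)%N -> r m <> r n.
  move=> mn e; have [_] := brP m; apply; rewrite e.
  by apply: (bmono _ _ mn); have [] := brP n.
have /infiniteP : [set: nat] #<= [set: R].
  apply: (@card_le_inj _ _ _ _ r) => // m n _ _ e.
  by case: (ltngtP m n) => // /rlt; rewrite e.
by apply.
Qed.

Lemma finite_elements : exists s : seq R, uniq s /\ forall x, x \in s.
Proof.
have /finite_seqP[s es] := finR; exists (undup s); split=> [|x].
  exact: undup_uniq.
by rewrite mem_undup; have : [set: R] x by []; rewrite es.
Qed.

Lemma finite_rsyz : rsyz_fg R.
Proof.
move=> n a; have [s [_ sP]] := finite_elements.
pose T := {ffun 'I_n -> 'I_(size s)}.
pose dec (t : T) : 'I_n -> R := fun i => s`_(t i).
have decP (u : 'I_n -> R) : exists t, u = dec t.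
  have us i : (index (u i) s < size s)%N by rewrite index_mem.
  exists [ffun i => Ordinal (us i)]; apply/funext => i.
  by rewrite /dec ffunE /= nth_index.
pose K (u : 'I_n -> R) := \sum_i a i * u i = 0.
pose k (j : 'I_#|T|) : 'I_n -> R :=
  if `[< K (dec (enum_val j)) >] then dec (enum_val j) else fun=> 0.
have kK j : K (k j).
  rewrite /k; case: asboolP => // _; rewrite /K big1// => i _.
  by rewrite mulr0.
exists #|T|, k => u; split=> [/= Ku|[r ur]] /=.
  have [t ut] := decP u; exists (fun j => (j == enum_rank t)%:R) => i.
  have -> : u = k (enum_rank t) by rewrite /k enum_rankK -ut asboolT.
  rewrite (bigD1 (enum_rank t))//= eqxx mulr1 big1 ?addr0// => j /negbTE ->.
  by rewrite mulr0.
under eq_bigr do rewrite ur mulr_sumr.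
rewrite exchange_big big1// => j _ /=.
by under eq_bigr do rewrite mulrA; rewrite -mulr_suml kK mul0r.
Qed.

Lemma finite_succ_card (I : Type) : succ_card R I -> finite_set [set: I].
Proof.
move=> [_ Imin]; apply: contrapT => infI.
have [f [_ finj]] := infinite_nat_inj infI.
have [s [us sP]] := finite_elements.
have Rs : [set: R] #<= `I_(size s).
  apply: (@card_le_inj _ _ _ _ (fun x => index x s)) => [x _|x y _ _ e].
    by rewrite /= index_mem.
  by rewrite -(nth_index 0 (sP x)) e nth_index.
have IJ : `I_(size s).+1 #<= f @` `I_(size s).+1.
  apply: (@card_le_inj _ _ _ _ f) => [n nI|m n _ _ /finj//]; exact: imageP.
have finJ : finite_set (f @` `I_(size s).+1).
  by apply: finite_image; exact: finite_II.
apply: infI; apply: card_le_finite finJ; apply: Imin; split.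
  apply: card_le_trans Rs _; apply: card_le_trans IJ; apply: subset_card_le.
  by move=> n /= /ltnW.
move=> /(card_le_trans IJ)/card_le_trans/(_ Rs).
by rewrite card_le_II ltnn.
Qed.

Lemma finite_dsum (I : choiceType) : finite_set [set: I] ->
  finite_set [set: direct_sum R I].
Proof.
move=> /finite_seqP[t It]; have [s [_ sP]] := finite_elements.
have tP i : i \in t by have : [set: I] i by []; rewrite It.
pose h (x : direct_sum R I) : {ffun 'I_(size t) -> 'I_(size s).+1} :=
  [ffun j => inord (index (dcoord (tnth (in_tuple t) j) x : R) s)].
have : [set: direct_sum R I] #<= [set: {ffun 'I_(size t) -> 'I_(size s).+1}].
  apply: (@card_le_inj _ _ _ _ h) => // x y _ _ /ffunP hxy.
  apply: dsum_ext => i; have /tnthP[j ->] : i \in in_tuple t by exact: tP.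
  have := hxy j; rewrite !ffunE => /(congr1 val) /=.
  rewrite !inordK ?ltnS ?index_size// => e.
  by rewrite -[LHS](nth_index 0 (sP _)) e nth_index.
by move=> /card_le_finite; apply; exact: finite_finset.
Qed.

End FiniteRing.

(** If each of the finitely many elements violates some formula of the type, the
    violated formulas form a finite subset that is not satisfiable. *)
Lemma finite_saturated (K : Type) (R : pzRingType) (M : lmodType R) :
  finite_set [set: M] -> saturated K M.
Proof.
move=> finM A _ p ptype; apply: contrapT => nreal.
have /choice[g gP] : forall x : M, exists f, p f /\ ~ satisfies set_val (fun=> x) f.
  move=> x; apply: contrapT => nf; apply: nreal; exists x => f pf.
  by apply: contrapT => nsat; apply: nf; exists f.
have [|_ [x _ <-]|x xq] := ptype (range g).
- exact: finite_image.
- by have [] := gP x.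
by have [_] := gP x; apply; apply: xq; exists x.
Qed.

(** * The theorem *)

(** If all but finitely many coordinates occurred in the supports of elements of
    A, choosing for each coordinate an element in whose support it lies would
    give a map from I to A with finite fibres, hence |I| <= |A|. *)
Lemma infinite_saturated (R : pzRingType) (I : choiceType) :
  infinite_set [set: I] -> rsyz_fg R -> fgr_dcc R -> saturated I (direct_sum R I).
Proof.
move=> infI syz dcc A [_ nIA] p ptype.
pose I1 := [set i | forall x, A x -> dcoord i x = 0].
apply: (realize_type syz dcc (I1 := I1)) ptype; last first.
  by move=> x i Ax /(_ x Ax).
move=> finI1; have [a0 Aa0] : exists a, A a.
  apply: contrapT => nA; apply: infI; rewrite (_ : [set: I] = I1)//.
  by apply/seteqP; split=> // i _ x Ax; case: nA; exists x.
have /choice[h hP] : forall i, exists x,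
    A x /\ (I1 i \/ dcoord i x != 0).
  move=> i; have [Ii|nIi] := pselect (I1 i); first by exists a0; split=> //; left.
  apply: contrapT => nx; apply: nIi => x Ax; apply/eqP; apply: contrapT => /negP xi.
  by apply: nx; exists x; split=> //; right.
apply: nIA; apply: (finite_to_one_card (h := h)) => // [i|a].
  by have [] := hP i.
apply: (@sub_finite_set _ _ (I1 `|` [set i | dcoord i a != 0])).
  by move=> i /= <-; have [_] := hP i.
by rewrite finite_setU; split=> //; exact: dcoord_fin.
Qed.

Theorem theorem3p15 (R : pzRingType) (I : Type) (hI : succ_card R I) :
  saturated I (direct_sum R I) <-> left_perfect R /\ right_coherent R.
Proof.
have [finR|infR] := pselect (finite_set [set: R]).
  split=> _.
    split; first exact/dcc_perfect/finite_dcc.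
    exact/right_coherentP/finite_rsyz.
  apply: finite_saturated; apply: (@finite_dsum R finR {classic I}).
  exact: finite_succ_card finR I hI.
have [ltRI _] := hI.
split=> [sat|[/perfect_dcc dcc /right_coherentP syz]].
  split; first exact/dcc_perfect/(@saturated_dcc R {classic I}).
  exact/right_coherentP/(@saturated_rsyz R {classic I}).
exact/(@infinite_saturated R {classic I})/dcc/syz/(@infI R {classic I}).
Qed.
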